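(* Let $\sigma>0$, $\xi_0<\xi_1$, $\Delta=\xi_1-\xi_0$ and $\bar\xi=(\xi_0+\xi_1)/2$. Let $f(t)=e^{2\pi i\xi_0t}+e^{2\pi i\xi_1t}$ (two components with equal amplitudes) and assume $\Delta\le\frac{\sqrt2}{\pi\sigma}$. For $k\in\mathbb{Z}$ define $$t^{L,k}_*=\frac{k}{\Delta}+\frac{1}{2\pi\Delta}\cos^{-1}\left(\pi^2\sigma^2\Delta^2-1\right),\qquad t^{R,k}_*=\frac{k+1}{\Delta}-\frac{1}{2\pi\Delta}\cos^{-1}\left(\pi^2\sigma^2\Delta^2-1\right),$$ and let $\gamma(t,\eta)=|V_f^{(h)}(t,\eta)|$. (i) If $t\in(t^{L,k}_*,t^{R,k}_* )$ for some $k\in\mathbb{Z}$, then $\eta\mapsto\gamma(t,\eta)$ has two local maxima. (ii) If $t\in(t^{R,k-1}_*,t^{L,k}_* )$ for some $k\in\mathbb{Z}$, then $\eta\mapsto\gamma(t,\eta)$ has one local maximum. (Thus a bifurcation occurs at the times $t_*^{L,k}$ and $t_*^{R,k}$.) (iii) For $k\in\mathbb{Z}$ let $E_k$ be the ellipse of points $(t,\eta)$ defined by $$2\pi^2\sigma^2\left(\eta-\bar\xi\right)^2+\frac{4\pi^2\Delta^2\left(t-\frac{k+1/2}{\Delta}\right)^2}{\arccos^2\left(1-\pi^2\sigma^2\Delta^2\right)}=1 .$$ Then, as $\Delta\to0$, $$\int_{E_k}\left|\frac{\partial}{\partial\eta}\gamma(t,\eta)^2\right|dr=O(\Delta^2),$$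 where $dr$ is the arc-length measure on $E_k$.
   Context: The window is the Gaussian $h(x)=\frac{1}{\sigma\sqrt{\pi}}e^{-x^2/\sigma^2}$ with $\sigma$ fixed. The (modified) short-time Fourier transform is $V_f^{(h)}(t,\eta)=\int_{-\infty}^\infty f(x)h(x-t)e^{-2\pi i\eta(x-t)}dx$; for the $f$ considered, $V_f^{(h)}(t,\eta)=e^{2\pi i\xi_0t}\left(e^{-\pi^2\sigma^2(\eta-\xi_0)^2}+e^{2\pi i\Delta t}e^{-\pi^2\sigma^2(\eta-\xi_1)^2}\right)$. *)

(* Defs.v *)
From mathcomp Require Import all_boot all_order all_algebra.
From mathcomp Require Import complex.
From mathcomp Require Import all_classical all_reals all_analysis.
From mathcomp Require Import ring lra.
Import Order.TTheory GRing.Theory Num.Theory.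
Import numFieldNormedType.Exports.

Set Implicit Arguments.
Unset Strict Implicit.
Unset Printing Implicit Defensive.

Local Open Scope classical_set_scope.
Local Open Scope ring_scope.
Local Open Scope complex_scope.

Section ShortTimeFourier.
Context {R : realType}.

Definition expi (theta : R) : R[i] := cos theta +i* sin theta.

Definition Cintegral (F : R -> R[i]) : R[i] :=
  (\int[lebesgue_measure]_x complex.Re (F x))
    +i* (\int[lebesgue_measure]_x complex.Im (F x)).

(* The phase is exp (- 2 pi i eta (x - t)), not exp (- 2 pi i eta x). *)
Definition stft (h : R -> R) (f : R -> R[i]) (t eta : R) : R[i] :=
  Cintegral (fun x =>
    f x * (h (x - t))%:C * expi (- (2 * pi * eta * (x - t)))).

Definition gaussian_window (sigma x : R) : R :=
  expR (- (x ^+ 2 / sigma ^+ 2)) / (sigma * Num.sqrt pi).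

Definition two_tone (xi0 xi1 t : R) : R[i] :=
  expi (2 * pi * xi0 * t) + expi (2 * pi * xi1 * t).

Definition stft_modulus (sigma xi0 xi1 t eta : R) : R :=
  ComplexField.Normc.normc
    (stft (gaussian_window sigma) (two_tone xi0 xi1) t eta).

Definition bifurcation_timeL (sigma Delta : R) (k : int) : R :=
  k%:~R / Delta
  + (2 * pi * Delta)^-1 * acos (pi ^+ 2 * sigma ^+ 2 * Delta ^+ 2 - 1).

Definition bifurcation_timeR (sigma Delta : R) (k : int) : R :=
  (k + 1)%:~R / Delta
  - (2 * pi * Delta)^-1 * acos (pi ^+ 2 * sigma ^+ 2 * Delta ^+ 2 - 1).

Definition local_maxima (g : R -> R) : set R :=
  [set x | \forall y \near x, g y <= g x].

End ShortTimeFourier.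

Section ArcLength.
Context {R : realType}.

(* The integral of F over a curve E with respect to arc length is computed
   along a C^1 regular parametrization c : [a, b] -> R^2 running through E
   exactly once.  Injectivity is asked on [a, b[ only, so that closed curves
   are covered.  Taking c to be C^1 on the whole line loses nothing, since a
   C^1 curve on [a, b] extends affinely beyond its end points. *)
Definition curve_speed (c : R -> R * R) (s : R) : R :=
  Num.sqrt (derive1 (fst \o c) s ^+ 2 + derive1 (snd \o c) s ^+ 2).

Definition regular_param (E : set (R * R)) (a b : R) (c : R -> R * R) : Prop :=
  [/\ a < b,
      (forall s, derivable (fst \o c) s 1) /\ continuous (derive1 (fst \o c)),
      (forall s, derivable (snd \o c) s 1) /\ continuous (derive1 (snd \o c)),
      (forall s, a <= s <= b -> curve_speed c s != 0) &
      set_bij `[a, b[ E c].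

Definition arc_length_integral (a b : R) (c : R -> R * R) (F : R * R -> R) :
    \bar R :=
  \int[lebesgue_measure]_(s in `[a, b]) (F (c s) * curve_speed c s)%:E.

End ArcLength.

Section Ellipse.
Context {R : realType}.

Definition bifurcation_ellipse (sigma xi0 xi1 : R) (k : int) : set (R * R) :=
  let Delta := xi1 - xi0 in
  [set p | 2 * pi ^+ 2 * sigma ^+ 2 * (p.2 - (xi0 + xi1) / 2) ^+ 2
           + 4 * pi ^+ 2 * Delta ^+ 2 * (p.1 - (k%:~R + 1 / 2) / Delta) ^+ 2
             / acos (1 - pi ^+ 2 * sigma ^+ 2 * Delta ^+ 2) ^+ 2 = 1].


Lemma ellipse_regular_param (x0 y0 A B : R) : 0 < A -> 0 < B ->
  regular_param
    [set p : R * R | ((p.1 - x0) / A) ^+ 2 + ((p.2 - y0) / B) ^+ 2 = 1]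
    0 (pi *+ 2) (fun s => (x0 + A * cos s, y0 + B * sin s)).
Proof.
move=> A0 B0.
have A1 : A != 0 by rewrite gt_eqF.
have B1 : B != 0 by rewrite gt_eqF.
have pi0 := pi_gt0 R.
have dx s : is_derive s (1 : R) (fst \o (fun s => (x0 + A * cos s, y0 + B * sin s)))
    (- (A * sin s)).
  rewrite (_ : _ \o _ = (fun s => x0 + A * cos s))//.
  by apply: is_derive_eq; rewrite ?add0r /GRing.scale /=; ring.
have dy s : is_derive s (1 : R) (snd \o (fun s => (x0 + A * cos s, y0 + B * sin s)))
    (B * cos s).
  rewrite (_ : _ \o _ = (fun s => y0 + B * sin s))//.
  by apply: is_derive_eq; rewrite ?add0r /GRing.scale /=; ring.
have Dx : derive1 (fst \o (fun s => (x0 + A * cos s, y0 + B * sin s))) =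
    (fun s => - (A * sin s)).
  by apply/funext => s; rewrite derive1E; apply: derive_val.
have Dy : derive1 (snd \o (fun s => (x0 + A * cos s, y0 + B * sin s))) =
    (fun s => B * cos s).
  by apply/funext => s; rewrite derive1E; apply: derive_val.
split.
- by rewrite mulr2n addr_gt0.
- split; first by move=> s; exact: ex_derive.
  rewrite Dx => s; apply: cvgN; apply: cvgM; first exact: cvg_cst.
  exact: continuous_sin.
- split; first by move=> s; exact: ex_derive.
  rewrite Dy => s; apply: cvgM; first exact: cvg_cst.
  exact: continuous_cos.
- move=> s _; rewrite /curve_speed Dx Dy sqrtr_eq0 -ltNge.
  rewrite lt_neqAle addr_ge0 ?sqr_ge0// andbT eq_sym paddr_eq0 ?sqr_ge0//.
  rewrite !sqrf_eq0 oppr_eq0 !mulf_eq0 (negbTE A1) (negbTE B1) /=.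
  apply/negP => /andP[/eqP s0 /eqP c0]; have := sin2cos2 s; rewrite s0 c0 expr0n/=.
  by move=> /eqP; rewrite subr0 eq_sym oner_eq0.
have S (s : R) : pi < s < pi *+ 2 -> sin s < 0.
  move=> /andP[p1 p2]; have -> : s = (s - pi) + pi by rewrite subrK.
  by rewrite sinDpi oppr_lt0 sin_gt0_pi// subr_gt0 p1 ltrBlDr -mulr2n.
have C (s : R) : cos s = cos (pi *+ 2 - s).
  by rewrite -[in RHS](cosN) opprB cosB cos2pi sin2pi; ring.
split.
- move=> s _ /=.
  have -> : (x0 + A * cos s - x0) / A = cos s by field.
  have -> : (y0 + B * sin s - y0) / B = sin s by field.
  by rewrite sin2cos2 addrC subrK.
- move=> s s'; rewrite !inE/= !in_itv/= => /andP[s0 s1] /andP[s'0 s'1].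
  move=> [/addrI/(mulfI A1) cE /addrI/(mulfI B1) sE].
  have [sp|sp] := leP s pi; have [s'p|s'p] := leP s' pi.
  + by apply: cos_inj => //; rewrite in_itv/= ?s0 ?s'0.
  + have := S s'; rewrite s'p s'1 -sE ltNge sin_ge0_pi ?s0// => /(_ isT)//.
  + have := S s; rewrite sp s1 sE ltNge sin_ge0_pi ?s'0// => /(_ isT)//.
  + have : pi *+ 2 - s = pi *+ 2 - s' by apply: cos_inj; rewrite ?in_itv/= -?C//; lra.
    by move=> /addrI/oppr_inj.
- move=> [u v] /=; set X := (u - x0) / A; set Y := (v - y0) / B => E.
  have Xb : -1 <= X <= 1.
    by rewrite -ler_norml -(ler_pXn2r (n := 2))// ?nnegrE// expr1n real_normK ?num_real// -E lerDl sqr_ge0.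
  have uE : u = x0 + A * X by rewrite /X; field.
  have vE : v = y0 + B * Y by rewrite /Y; field.
  have aX := acos_ge0 Xb; have aX' := acos_lepi Xb.
  have cX : cos (acos X) = X by apply: acosK; rewrite in_itv.
  have sX : sin (acos X) ^+ 2 = Y ^+ 2 by rewrite sin2cos2 cX -E addrAC subrr add0r.
  have sX0 : 0 <= sin (acos X) by rewrite sin_ge0_pi// aX.
  have [Y0|Y0] := leP 0 Y.
    exists (acos X); first by rewrite /= in_itv/= aX/=; lra.
    rewrite cX uE vE; congr (_, _ + _ * _).
    by apply/eqP; rewrite -(eqrXn2 (n := 2))//; apply/eqP.
  have sY : sin (acos X) = - Y.
    by apply/eqP; rewrite -(eqrXn2 (n := 2))// ?oppr_ge0 ?ltW// sqrrN; apply/eqP.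
  exists (pi *+ 2 - acos X).
    rewrite /= in_itv/=; apply/andP; split; first lra.
    rewrite ltrBlDr ltrDl lt_neqAle aX andbT.
    by apply/negP => /eqP a0; move: sY; rewrite -a0 sin0; lra.
  by rewrite -C cX sinB cos2pi sin2pi sY uE vE; congr (_, _ + _ * _); ring.
Qed.

(* Statements quantifying over the parametrizations of the ellipse are thus
   not vacuous. *)
Lemma bifurcation_ellipse_regular_param (sigma xi0 xi1 : R) (k : int) :
  0 < sigma -> xi0 < xi1 -> xi1 - xi0 <= Num.sqrt 2 / (pi * sigma) ->
  exists c, regular_param (bifurcation_ellipse sigma xi0 xi1 k) 0 (pi *+ 2) c.
Proof.
move=> s0 x01; set D := xi1 - xi0 => Dle.
have D0 : 0 < D by rewrite subr_gt0.
have pi0 := pi_gt0 R.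
set q := pi ^+ 2 * sigma ^+ 2 * D ^+ 2.
have q0 : 0 < q by rewrite /q !mulr_gt0 ?exprn_gt0.
have q2 : q <= 2.
  move: Dle; rewrite ler_pdivlMr ?mulr_gt0// => Dle.
  rewrite -[leRHS](@sqr_sqrtr R 2)// /q -!exprMn ler_pXn2r ?nnegrE ?sqrtr_ge0//.
    by rewrite mulrC.
  by rewrite !mulr_ge0 ?ltW.
have a0 : 0 < acos (1 - q) by apply: acos_gt0; apply/andP; split; lra.
have r0 : 0 < Num.sqrt (2 : R) by rewrite sqrtr_gt0.
set A := acos (1 - q) / (2 * pi * D); set B := (Num.sqrt 2 * pi * sigma)^-1.
have A0 : 0 < A by rewrite divr_gt0// !mulr_gt0.
have B0 : 0 < B by rewrite invr_gt0 !mulr_gt0.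
eexists.
rewrite (_ : bifurcation_ellipse _ _ _ _ =
  [set p : R * R | ((p.1 - (k%:~R + 1 / 2) / D) / A) ^+ 2
                   + ((p.2 - (xi0 + xi1) / 2) / B) ^+ 2 = 1]).
  exact: ellipse_regular_param.
have E (u v : R) :
    2 * pi ^+ 2 * sigma ^+ 2 * (v - (xi0 + xi1) / 2) ^+ 2
    + 4 * pi ^+ 2 * D ^+ 2 * (u - (k%:~R + 1 / 2) / D) ^+ 2 / acos (1 - q) ^+ 2
    = ((u - (k%:~R + 1 / 2) / D) / A) ^+ 2 + ((v - (xi0 + xi1) / 2) / B) ^+ 2.
  rewrite /A /B invrK !invf_div !exprMn sqr_sqrtr//.
  by field; rewrite !gt_eqF.
by apply/funext => -[u v]; rewrite /bifurcation_ellipse /= -/D -/q E.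
Qed.
End Ellipse.

(* Main.v *)
Require Import Defs.
From mathcomp Require Import all_boot all_order all_algebra.
From mathcomp Require Import complex.
From mathcomp Require Import all_classical all_reals all_analysis.
From mathcomp Require Import measurable_realfun.
From mathcomp Require Import ring lra.
Import Order.TTheory GRing.Theory Num.Theory.
Import numFieldNormedType.Exports.
Local Open Scope classical_set_scope.
Local Open Scope ring_scope.

(** Write [c] for (pi sigma)^2, [D] for the separation of the two frequencies,
    [q] for [c D^2], [y] for the offset of [eta] from the mean frequency,
    [u = 2 c D y] and [k = cos (2 pi D t)].

    The transform of a pure tone through a Gaussian window is, up to a phase,
    the characteristic function of a normal law.  It satisfies a linear
    differential equation in the frequency, obtained by differentiating under
    the integral and integrating by parts ([integral_cos_normal_pdf]).  Hence
    the closed form of [stft_two_tone], and for the squared modulus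
    [2 exp (- q / 2) exp (- 2 c y^2) (cosh u + k)] ([stft_modulus_sqr]): the
    two bells overlap into an even function of [y] that depends on the time
    through [k] only.

    Its derivative in [eta] has the sign of the odd function
    [slope q k u = q sinh u - u (cosh u + k)].  For [u > 0] this is the sign of
    [h u - k] with [h u = q sinh u / u - cosh u], and [h] decreases from its
    limit [q - 1] at 0 to minus infinity as soon as [q <= 2], which is the
    assumption on the separation ([sinhc_sub_cosh_decr]).  If [k > q - 1] the
    squared modulus decreases on both sides of the mean frequency, which is
    its only local maximum; if [k < q - 1] it rises from there to a point on
    each side and falls beyond, which gives two local maxima.  The bifurcation
    times are the solutions in [t] of [k = q - 1].

    On the ellipse, [2 c y^2 <= 1] and [1 + k <= q], because
    the half-axis in time is the phase at which [1 + k] reaches [q].  Then [u]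
    has order [sqrt q], the bracket [(cosh u - 1) + (1 + k)] has order [q], and
    the derivative of the squared modulus has order [q], that is [D^2], with a
    constant depending on [sigma] only ([norm_derive_modulus_sqr_le]).  The
    half-axes of the ellipse stay bounded as [D] tends to 0, so what is left
    is to bound its length for an arbitrary regular injective parametrization.
    After rescaling to the unit circle the speed is controlled by the angular
    velocity, which cannot vanish and so keeps its sign, while the total angle
    cannot exceed [2 pi] without contradicting injectivity
    ([circle_angle_le_2pi], [ellipse_arc_length_integral_le]). *)

(** * The characteristic function of the normal law *)

Lemma derivable1_continuous (R : realType) (f : R -> R) (x : R) :
  derivable f x 1 -> {for x, continuous f}.
Proof. by move=> df; apply: differentiable_continuous; apply/derivable1_diffP. Qed.

Lemma is_derive_normal_pdf (R : realType) (m s x : R) : s != 0 ->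
  is_derive x (1 : R) (normal_pdf m s) (- ((x - m) / s ^+ 2) * normal_pdf m s x).
Proof.
move=> s0; rewrite normal_pdfE//.
rewrite (_ : (fun x => _) = normal_peak s \*: (expR \o (fun x => - (x - m) ^+ 2 / (s ^+ 2 *+ 2))))//.
apply: is_derive_eq.
rewrite /GRing.scale /= /normal_fun; field => //.
Qed.

Lemma cvg_normal_pdf_nat (R : realType) (m s : R) : s != 0 ->
  normal_pdf m s n%:R @[n --> \oo] --> (0 : R).
Proof.
move=> s0; rewrite normal_pdfE// /normal_fun.
rewrite -[X in _ --> X](mulr0 (normal_peak s)); apply: cvgM; first exact: cvg_cst.
rewrite (_ : (fun n : nat => _) =
    (fun x => expR (- x)) \o (fun x => x / (s ^+ 2 *+ 2)) \o (fun x => x ^+ 2)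
    \o (fun x => x - m) \o (fun n : nat => n%:R)); last first.
  by apply/funext => n /=; rewrite mulNr.
apply: cvg_comp; first exact: cvgr_idn.
apply: cvg_comp; first exact: cvg_addrr.
apply: cvg_comp; first exact: cvgr_expr2.
apply: cvg_comp; last exact: cvgr_expR.
apply: gt0_cvgMly; last exact: cvg_id.
by rewrite invr_gt0 pmulrn_lgt0// exprn_even_gt0.
Qed.

(** Over [[-n, n]] the integral of the derivative is the boundary term, which
    vanishes as [n] grows; dominated convergence, with the absolute value of
    the derivative as bound, extends this to the line.  This is the form in
    which integration by parts is used below. *)
Lemma integral_derivative_eq0 (R : realType) (F f : R -> R) :
  (forall x, is_derive x (1:R) F (f x)) -> continuous f ->
  lebesgue_measure.-integrable [set: R] (EFin \o f) ->
  F n%:R @[n --> \oo] --> (0 : R) ->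
  F (- n%:R) @[n --> \oo] --> (0 : R) ->
  \int[lebesgue_measure]_x f x = 0.
Proof.
move=> dF cf intf F0 F0'.
have cF : continuous F.
  by move=> x; apply: derivable1_continuous; exact: ex_derive.
have E n : (\int[lebesgue_measure]_(x in `[(- n%:R)%R, n%:R%R]) (f x)%:E = (F n%:R - F (- n%:R))%R%:E)%E.
  have [->|n0] := eqVneq n 0.
    by rewrite oppr0 set_itv1 integral_set1 subrr.
  rewrite (@continuous_FTC2 _ f F)//.
  - by rewrite -subr_gt0 opprK addr_gt0// ltr0n lt0n.
  - exact: continuous_subspaceT.
  - split=> //.
    + by apply: cvg_at_right_filter; exact: cF.
    + by apply: cvg_at_left_filter; exact: cF.
  - by move=> x _; rewrite derive1E; exact: derive_val.
pose g (n : nat) (x : R) := ((f \_ `[- n%:R, n%:R]) x)%:E.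
have mf : measurable_fun setT f by exact: continuous_measurable_fun.
have mg n : measurable_fun setT (g n).
  apply/measurable_EFinP.
  by apply/(measurable_restrictT _ _).1 => //; exact: measurable_funTS.
have gf : {ae lebesgue_measure, forall x, setT x -> g n x @[n --> \oo] --> (EFin \o f) x}.
  apply: aeW => x _; apply: cvg_near_cst.
  near=> n; rewrite /g patchE ifT//= inE/= in_itv/= -ler_norml.
  by near: n; exact: nbhs_infty_ger.
pose af (x : R) : \bar R := `|(f x)%:E|%E.
have gub : {ae lebesgue_measure, forall x n, setT x -> (`|g n x| <= af x)%E}.
  apply: aeW => x n _; rewrite /g /af patchE.
  by case: ifP => // _; rewrite abse0 abse_ge0.
have iaf : lebesgue_measure.-integrable setT af.
  exact: integrable_abse intf.
have mf' : measurable_fun setT (EFin \o f) by exact/measurable_EFinP.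
have [_ _ H] := @dominated_convergence _ _ _ (@lebesgue_measure R) setT measurableT g (EFin \o f) af mg mf' gf iaf gub.
have H' : (\int[lebesgue_measure]_x g n x)%E @[n --> \oo] --> 0%E.
  rewrite (_ : (fun n => _) = (fun n => (F n%:R - F (- n%:R))%:E)); last first.
    apply/funext => n; rewrite -E [RHS]integral_mkcond.
    by apply: eq_integral => x _; rewrite /g !patchE; case: ifP.
  apply: cvg_EFin; first exact: nearW.
  by rewrite -[0%R](subrr (0:R)); exact: cvgB.
have E0 := cvg_unique _ H H'.
by rewrite /Rintegral E0.
Unshelve. all: by end_near. Qed.

Lemma integrable_normal_pdfM (R : realType) (m s C : R) (g : R -> R) :
  measurable_fun setT g -> (forall x, `|g x| <= C) ->
  lebesgue_measure.-integrable [set: R] (fun x => (g x * normal_pdf m s x)%:E).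
Proof.
move=> mg gC; have C0 : 0 <= C by apply: le_trans (gC 0).
have H : lebesgue_measure.-integrable [set: R] (fun x => C%:E * (normal_pdf m s x)%:E)%E.
  by apply: integrableZl => //; exact: integrable_normal_pdf.
apply: (le_integrable _ _ _ H) => //.
  apply/measurable_EFinP; apply: measurable_funM => //.
  exact: measurable_normal_pdf.
move=> x _; rewrite -EFinM lee_fin !normrM ler_wpM2r//.
by rewrite (le_trans (gC x))// ler_norm.
Qed.

(** The factor [x - m] is absorbed by doubling the standard deviation: the
    quotient of the two Gaussians is [exp (- 3 (x - m)^2 / (8 s^2))], which
    outweighs any linear growth. *)
Lemma integrable_normal_pdf_moment (R : realType) (m s C : R) (g : R -> R) :
  s != 0 -> measurable_fun setT g -> (forall x, `|g x| <= C) ->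
  lebesgue_measure.-integrable [set: R]
    (fun x => ((x - m) * g x * normal_pdf m s x)%:E).
Proof.
move=> s0 mg gC; have C0 : 0 <= C by apply: le_trans (gC 0).
have ss : 0 < s ^+ 2 by rewrite exprn_even_gt0.
have s20 : 2 * s != 0 by rewrite mulf_neq0.
pose M := C * (1 + 8 * s ^+ 2) * normal_peak s / normal_peak (2 * s).
have H : lebesgue_measure.-integrable [set: R] (fun x => M%:E * (normal_pdf m (2 * s) x)%:E)%E.
  by apply: integrableZl => //; exact: integrable_normal_pdf.
have p2 := normal_peak_gt0 s20; have p1 := normal_peak_gt0 s0.
have k0 : 0 <= 1 + 8 * s ^+ 2 by rewrite addr_ge0// mulr_ge0// ltW.
have M0 : 0 <= M by apply: divr_ge0; last exact: ltW; apply: mulr_ge0; [exact: mulr_ge0|exact: ltW].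
apply: (le_integrable _ _ _ H) => //.
  apply/measurable_EFinP; apply: measurable_funM => //.
    by apply: measurable_funM => //; exact: measurable_funB.
  exact: measurable_normal_pdf.
move=> x _; rewrite -EFinM lee_fin (ger0_norm (mulr_ge0 M0 (normal_pdf_ge0 _ _ _))).
rewrite !normrM (ger0_norm (normal_pdf_ge0 _ _ _)) !normal_pdfE//.
rewrite /M; rewrite [leRHS](_ : _ = C * (1 + 8 * s ^+ 2) * (normal_peak s * normal_fun m (2 * s) x)); last first.
  by field; rewrite gt_eqF.
rewrite [leRHS](_ : _ = C * normal_peak s * ((1 + 8 * s ^+ 2) * normal_fun m (2 * s) x)); last by ring.
rewrite [leLHS](_ : _ = `|g x| * normal_peak s * (`|x - m| * normal_fun m s x)); last by ring.
apply: ler_pM => //.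
- by rewrite mulr_ge0// ltW.
- by rewrite mulr_ge0// expR_ge0.
- by rewrite ler_wpM2r// ltW.
set y := x - m.
have -> : normal_fun m s x = expR (- (3 * y ^+ 2 / (8 * s ^+ 2))) * normal_fun m (2 * s) x.
  rewrite /normal_fun -expRD; congr expR; rewrite -/y; field => //.
rewrite mulrA ler_wpM2r ?expR_ge0//.
rewrite expRN ler_pdivrMr ?expR_gt0//.
(* [exp z >= 1 + z] bounds the exponential from below by a quadratic *)
have h : 1 + 3 * y ^+ 2 / (8 * s ^+ 2) <= expR (3 * y ^+ 2 / (8 * s ^+ 2)) by exact: expR_ge1Dx.
have h1 : (1 + 8 * s ^+ 2) * (1 + 3 * y ^+ 2 / (8 * s ^+ 2)) <=
          (1 + 8 * s ^+ 2) * expR (3 * y ^+ 2 / (8 * s ^+ 2)).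
  by rewrite ler_wpM2l// addr_ge0// mulr_ge0// ltW.
apply: le_trans h1.
have -> : (1 + 8 * s ^+ 2) * (1 + 3 * y ^+ 2 / (8 * s ^+ 2)) =
  1 + 3 * y ^+ 2 + (8 * s ^+ 2 + 3 * y ^+ 2 / (8 * s ^+ 2)) by field.
apply: (@le_trans _ _ (1 + 3 * y ^+ 2)); last first.
  by rewrite lerDl addr_ge0// ?divr_ge0// mulr_ge0 ?sqr_ge0 ?ltW.
by rewrite -(real_normK (num_real y)); have := normr_ge0 y; nra.
Qed.

(** The shift [c] of the phase treats the real and imaginary parts of the
    characteristic function at once.  With [F b] the integral, differentiation
    under the integral gives minus the integral [S b] of
    [(x - m) sin (b (x - m) + c)] against the density; since the derivative of
    the density is [- (x - m) / s^2] times itself, integrating the derivative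
    of [sin (b (x - m) + c)] times the density gives [S b = s^2 b F b].  So
    [F b exp (s^2 b^2 / 2)] is constant, equal to [F 0 = cos c]. *)
Lemma integral_cos_normal_pdf (R : realType) (m s b c : R) : s != 0 ->
  \int[lebesgue_measure]_x (cos (b * (x - m) + c) * normal_pdf m s x) =
  cos c * expR (- (s ^+ 2 * b ^+ 2 / 2)).
Proof.
move=> s0.
pose p := normal_pdf m s.
pose f (b x : R) := cos (b * (x - m) + c) * p x.
pose F b := \int[lebesgue_measure]_x f b x.
pose S b := \int[lebesgue_measure]_x ((x - m) * sin (b * (x - m) + c) * p x).
have cphase a : continuous (fun x : R => a * (x - m) + c).
  move=> x; apply: cvgD; last exact: cvg_cst.
  apply: cvgM; first exact: cvg_cst.
  by apply: cvgB; [exact: cvg_id|exact: cvg_cst].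
have ccos a : continuous (fun x : R => cos (a * (x - m) + c)).
  by move=> x; apply: (continuous_comp (cphase a x)); exact: continuous_cos.
have csin a : continuous (fun x : R => sin (a * (x - m) + c)).
  by move=> x; apply: (continuous_comp (cphase a x)); exact: continuous_sin.
have cp : continuous p by exact: continuous_normal_pdf.
have intf a : lebesgue_measure.-integrable [set: R] (EFin \o f a).
  apply: (integrable_normal_pdfM _ _ _ 1) => [|x]; last exact: cos_max.
  exact: continuous_measurable_fun.
have intS a : lebesgue_measure.-integrable [set: R]
    (fun x => ((x - m) * sin (a * (x - m) + c) * p x)%:E).
  apply: (integrable_normal_pdf_moment _ _ _ 1) => [//||x]; last exact: sin_max.
  exact: continuous_measurable_fun.
have df (a x : R) : is_derive a (1 : R) (f^~ x) (- ((x - m) * sin (a * (x - m) + c) * p x)).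
  rewrite /f (_ : (fun b => _) = p x \*: (cos \o (fun b : R => b * (x - m) + c))); last first.
    by apply/funext => z /=; rewrite mulrC.
  by apply: is_derive_eq; rewrite /GRing.scale/=; ring.
have dF a : is_derive a (1 : R) F (- S a).
  pose G y := `|(y - m) * 1 * p y|.
  have intG : lebesgue_measure.-integrable [set: R] (EFin \o G).
    have intg : lebesgue_measure.-integrable [set: R] (fun y => ((y - m) * 1 * p y)%:E).
      by apply: (integrable_normal_pdf_moment _ _ _ 1 (fun=> 1)) => // x; rewrite normr1.
    exact: integrable_abse intg.
  have G0 y : 0 <= G y by exact: normr_ge0.
  have Ia : `]a - 1, a + 1[%classic a by rewrite /= in_itv/=; apply/andP; split; lra.
  have d1fE (x y : R) : partial1of2 f x y = - ((y - m) * sin (x * (y - m) + c) * p y).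
    by rewrite partial1of2E; apply: derive_val.
  have Gub (x y : R) : `]a - 1, a + 1[%classic x -> [set: R] y -> `|partial1of2 f x y| <= G y.
    move=> _ _; rewrite d1fE normrN /G !normrM normr1 ler_wpM2r// ler_wpM2l//.
    exact: sin_max.
  have dex (x y : R) : `]a - 1, a + 1[%classic x -> [set: R] y -> derivable (f^~ y) x 1.
    by move=> _ _; exact: ex_derive.
  apply: DeriveDef.
    exact: (derivable_under_integral measurableT Ia (fun x _ => intf x) dex G0 intG Gub).
  rewrite -derive1E.
  rewrite (differentiation_under_integral measurableT Ia (fun x _ => intf x) dex G0 intG Gub).
  under eq_Rintegral do rewrite d1fE -mulN1r.
  by rewrite RintegralZl ?mulN1r//; exact: intS.
have IBP a : S a = s ^+ 2 * a * F a.
  pose H (x : R) := sin (a * (x - m) + c) * p x.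
  pose h (x : R) := a * f a x - s ^- 2 * ((x - m) * sin (a * (x - m) + c) * p x).
  have dH (x : R) : is_derive x (1 : R) H (h x).
    have dp := is_derive_normal_pdf R m s x s0.
    rewrite (_ : H = (sin \o (fun x => a * (x - m) + c)) * p)//.
    apply: is_derive_eq; rewrite /h /f /GRing.scale/= /p; field => //.
  have cxm : continuous (fun x : R => x - m).
    by move=> x; apply: cvgB; [exact: cvg_id|exact: cvg_cst].
  have ch : continuous h.
    rewrite /h /f => x; apply: cvgB; apply: cvgM; first exact: cvg_cst.
    - by apply: cvgM; [exact: ccos|exact: cp].
    - exact: cvg_cst.
    - apply: cvgM; last exact: cp.
      by apply: cvgM; [exact: cxm|exact: csin].
  have inth1 := integrableZl measurableT a (intf a).
  have inth2 := integrableZl measurableT (s ^- 2) (intS a).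
  have inth : lebesgue_measure.-integrable [set: R] (EFin \o h).
    exact: (integrableB measurableT inth1 inth2).
  have Hp (u : nat -> R) : p (u n) @[n --> \oo] --> (0 : R) ->
      H (u n) @[n --> \oo] --> (0 : R).
    move=> pu; apply/norm_cvg0P.
    apply: (squeeze_cvgr _ (@cvg_cst _ (0 : R) _ _ _) pu).
    apply: nearW => n; rewrite normr_ge0/= normrM.
    by rewrite (ger0_norm (normal_pdf_ge0 _ _ _)) ler_piMl ?normal_pdf_ge0// sin_max.
  have pN n : p (- n%:R) = normal_pdf (- m) s n%:R.
    rewrite /p !normal_pdfE// /normal_fun (_ : - n%:R - m = - (n%:R - - m)) ?sqrrN//.
    by rewrite opprB addrC.
  have := integral_derivative_eq0 R H h dH ch inth (Hp (fun n => n%:R) (cvg_normal_pdf_nat R m s s0)).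
  have pN0 : p (- n%:R) @[n --> \oo] --> (0 : R).
    by under eq_fun do rewrite pN; exact: cvg_normal_pdf_nat.
  move=> /(_ (Hp (fun n => - n%:R) pN0)).
  rewrite (RintegralB measurableT inth1 inth2).
  rewrite (RintegralZl _ measurableT (intf a)) (RintegralZl _ measurableT (intS a)).
  rewrite -/(S a) -/(F a) => /eqP.
  rewrite subr_eq0 => /eqP aF.
  have -> : S a = s ^+ 2 * (s ^- 2 * S a) by field.
  by rewrite -aF; ring.
have dE (a : R) : is_derive a (1 : R) (fun b => F b * expR (s ^+ 2 * b ^+ 2 / 2)) 0.
  rewrite (_ : (fun b => _) = F * (expR \o (fun b => s ^+ 2 * b ^+ 2 / 2)))//.
  by apply: is_derive_eq; rewrite IBP /GRing.scale/=; field.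
have FE := is_derive_0_is_cst b 0 dE.
have F0 : F 0 = cos c.
  rewrite /F /f; under eq_Rintegral do rewrite mul0r add0r.
  rewrite RintegralZl//; last exact: integrable_normal_pdf.
  by rewrite /Rintegral integral_normal_pdf/= mulr1.
rewrite -/(f b) -/(F b) -F0 expRN; move: FE; rewrite expr0n/= mulr0 mul0r expR0 mulr1 => <-.
by rewrite mulfK// gt_eqF// expR_gt0.
Qed.

(** * The transform of the two-tone signal *)

Lemma integral_sin_normal_pdf (R : realType) (m s b c : R) : s != 0 ->
  \int[lebesgue_measure]_x (sin (b * (x - m) + c) * normal_pdf m s x) =
  sin c * expR (- (s ^+ 2 * b ^+ 2 / 2)).
Proof.
move=> s0; rewrite -(cosBpihalf c) -(integral_cos_normal_pdf R m)//.
by apply: eq_Rintegral => x _; rewrite addrA cosBpihalf.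
Qed.

(** The window has no factor 2 in its exponent, hence the standard deviation
    [sigma / sqrt 2]. *)
Lemma gaussian_windowE (R : realType) (sigma t x : R) : 0 < sigma ->
  gaussian_window sigma (x - t) = normal_pdf t (sigma / Num.sqrt 2) x.
Proof.
move=> s0; have r0 : 0 < Num.sqrt (2 : R) by rewrite sqrtr_gt0.
rewrite normal_pdfE; last by rewrite gt_eqF// divr_gt0.
have sE : (sigma / Num.sqrt 2) ^+ 2 = sigma ^+ 2 / 2 by rewrite exprMn exprVn sqr_sqrtr.
rewrite /normal_peak /normal_fun sE /gaussian_window mulrC; congr (_^-1 * expR _).
  rewrite (_ : sigma ^+ 2 / 2 * pi *+ 2 = sigma ^+ 2 * pi); last by field.
  by rewrite sqrtrM ?sqr_ge0// sqrtr_sqr gtr0_norm.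
by field; rewrite gt_eqF.
Qed.

(** The phase [2 pi xi x - 2 pi eta (x - t)] is affine in [x - t] with slope
    [2 pi (xi - eta)] and constant term [2 pi xi t], so each tone contributes a
    value of the characteristic function of the normal law centred at [t]. *)
Lemma stft_two_tone (R : realType) (sigma xi0 xi1 t eta : R) : 0 < sigma ->
  stft (gaussian_window sigma) (two_tone xi0 xi1) t eta =
  expi (2 * pi * xi0 * t) * (expR (- (pi ^+ 2 * sigma ^+ 2 * (eta - xi0) ^+ 2)))%:C%C
  + expi (2 * pi * xi1 * t) * (expR (- (pi ^+ 2 * sigma ^+ 2 * (eta - xi1) ^+ 2)))%:C%C.
Proof.
move=> sigma_gt0; pose s := sigma / Num.sqrt 2.
have r0 : 0 < Num.sqrt (2 : R) by rewrite sqrtr_gt0.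
have s0 : s != 0 by rewrite gt_eqF// divr_gt0.
have sE : s ^+ 2 = sigma ^+ 2 / 2 by rewrite /s exprMn exprVn sqr_sqrtr.
pose b xi := 2 * pi * (xi - eta).
pose c xi := 2 * pi * xi * t.
have bE xi : - (s ^+ 2 * b xi ^+ 2 / 2) = - (pi ^+ 2 * sigma ^+ 2 * (eta - xi) ^+ 2).
  by rewrite sE /b; field.
have intC xi : lebesgue_measure.-integrable [set: R]
    (fun x => (cos (b xi * (x - t) + c xi) * normal_pdf t s x)%:E).
  apply: (integrable_normal_pdfM _ _ _ 1) => [|x]; last exact: cos_max.
  apply: measurableT_comp => //; first by apply: continuous_measurable_fun; exact: continuous_cos.
  by apply: measurable_funD => //; apply: measurable_funM => //; exact: measurable_funB.
have intS xi : lebesgue_measure.-integrable [set: R]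
    (fun x => (sin (b xi * (x - t) + c xi) * normal_pdf t s x)%:E).
  apply: (integrable_normal_pdfM _ _ _ 1) => [|x]; last exact: sin_max.
  apply: measurableT_comp => //; first by apply: continuous_measurable_fun; exact: continuous_sin.
  by apply: measurable_funD => //; apply: measurable_funM => //; exact: measurable_funB.
have phase xi x : 2 * pi * xi * x = (b xi * (x - t) + c xi) + 2 * pi * eta * (x - t).
  by rewrite /b /c; ring.
have expiM u v : cos (u + v) * cos v + sin (u + v) * sin v = cos u :> R.
  by rewrite -cosB addrK.
have expiM' u v : sin (u + v) * cos v - cos (u + v) * sin v = sin u :> R.
  by rewrite -sinB addrK.
rewrite /stft /Cintegral /two_tone /expi.
rewrite (_ : \int[_]_x _ = \int[lebesgue_measure]_x
   (cos (b xi0 * (x - t) + c xi0) * normal_pdf t s x +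
    cos (b xi1 * (x - t) + c xi1) * normal_pdf t s x)); last first.
  apply: eq_Rintegral => x _ /=.
  rewrite gaussian_windowE// -/s cosN sinN (phase xi0) (phase xi1).
  rewrite -(expiM (b xi0 * (x - t) + c xi0) (2 * pi * eta * (x - t))).
  rewrite -(expiM (b xi1 * (x - t) + c xi1) (2 * pi * eta * (x - t))).
  by ring.
rewrite [X in (_ +i* X)%C] (_ : \int[_]_x _ = \int[lebesgue_measure]_x
   (sin (b xi0 * (x - t) + c xi0) * normal_pdf t s x +
    sin (b xi1 * (x - t) + c xi1) * normal_pdf t s x)); last first.
  apply: eq_Rintegral => x _ /=.
  rewrite gaussian_windowE// -/s cosN sinN (phase xi0) (phase xi1).
  rewrite -(expiM' (b xi0 * (x - t) + c xi0) (2 * pi * eta * (x - t))).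
  rewrite -(expiM' (b xi1 * (x - t) + c xi1) (2 * pi * eta * (x - t))).
  by ring.
rewrite (RintegralD measurableT (intC xi0) (intC xi1)) (RintegralD measurableT (intS xi0) (intS xi1)).
rewrite !integral_cos_normal_pdf// !integral_sin_normal_pdf// !bE.
by apply/eqP; rewrite eq_complex /=; apply/andP; split; apply/eqP; rewrite /c; ring.
Qed.

(** * Hyperbolic functions and the slope of the profile *)

Section Hyperbolic.
Context {R : realType}.
Implicit Types (q k u v : R).

Definition cosh u := (expR u + expR (- u)) / 2.
Definition sinh u := (expR u - expR (- u)) / 2.

Lemma cosh0 : cosh 0 = 1.
Proof. by rewrite /cosh oppr0 expR0; field. Qed.

Lemma sinh0 : sinh 0 = 0.
Proof. by rewrite /sinh oppr0 subrr mul0r. Qed.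

Lemma coshN u : cosh (- u) = cosh u.
Proof. by rewrite /cosh opprK addrC. Qed.

Lemma sinhN u : sinh (- u) = - sinh u.
Proof. by rewrite /sinh opprK -mulNr opprB. Qed.

Global Instance is_derive_cosh u : is_derive u (1 : R) cosh (sinh u).
Proof.
rewrite (_ : cosh = 2^-1 \*: (expR + (expR \o -%R))); last first.
  by apply/funext => v /=; rewrite /cosh mulrC.
by apply: is_derive_eq; rewrite /sinh /GRing.scale/=; field.
Qed.

Global Instance is_derive_sinh u : is_derive u (1 : R) sinh (cosh u).
Proof.
rewrite (_ : sinh = 2^-1 \*: (expR - (expR \o -%R))); last first.
  by apply/funext => v /=; rewrite /sinh mulrC.
by apply: is_derive_eq; rewrite /cosh /GRing.scale/=; field.
Qed.

Lemma is_derive_gt0_lt (f df : R -> R) (a b : R) :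
  (forall x, a <= x <= b -> is_derive x (1 : R) f (df x)) -> a < b ->
  (forall x, a < x < b -> 0 < df x) -> f a < f b.
Proof.
move=> fdf ab df0.
have fab : {within `[a, b], continuous f}.
  apply: derivable_within_continuous => x; rewrite in_itv/= => xab.
  by have := fdf x xab => ?; exact: ex_derive.
have fdf' x : x \in `]a, b[ -> is_derive x (1 : R) f (df x).
  by rewrite in_itv/= => /andP[ax xb]; apply: fdf; rewrite !ltW.
have [x xab E] := MVT ab fdf' fab.
by rewrite -subr_gt0 E mulr_gt0 ?subr_gt0// df0//; rewrite in_itv in xab.
Qed.

Lemma lt_sinh u v : u < v -> sinh u < sinh v.
Proof.
by move=> uv; rewrite /sinh ltr_pM2r ?invr_gt0// ltrD ?ltrN2 ?ltr_expR ?ltrN2.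
Qed.

Lemma sinh_gt0 u : 0 < u -> 0 < sinh u.
Proof. by move=> /lt_sinh; rewrite sinh0. Qed.

Lemma cosh_gt0 u : 0 < cosh u.
Proof. by rewrite divr_gt0// addr_gt0 ?expR_gt0. Qed.

Lemma cosh_gt1 u : 0 < u -> 1 < cosh u.
Proof.
move=> u0; rewrite -cosh0; apply: (is_derive_gt0_lt cosh sinh) => // x; by move=> /andP[x0 _]; exact: sinh_gt0.
Qed.

Lemma cosh_ge1 u : 1 <= cosh u.
Proof.
have [u0|u0|->] := ltgtP u 0; last by rewrite cosh0.
  by rewrite -coshN ltW// cosh_gt1// oppr_gt0.
by rewrite ltW// cosh_gt1.
Qed.

(** Up to a positive factor, the derivative in [eta] of the squared modulus,
    in the variables described above ([is_derive_stft_modulus_sqr]). *)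
Definition slope q k u := q * sinh u - u * (cosh u + k).

Lemma slopeN q k u : slope q k (- u) = - slope q k u.
Proof. by rewrite /slope sinhN coshN; ring. Qed.

(** As [k > q - 1], it suffices that [q (sinh u - u) < u (cosh u - 1)].  The
    two sides agree at 0, and their derivatives are compared using
    [cosh u - 1 < u sinh u] and [q <= 2]. *)
Lemma slope_lt0 q k u : q <= 2 -> q - 1 < k -> 0 < u -> slope q k u < 0.
Proof.
move=> q2 qk u0.
pose M v := v * (cosh v - 1) - q * (sinh v - v).
pose dM v := cosh v - 1 + v * sinh v - q * (cosh v - 1).
have dMP (v : R) : is_derive v (1 : R) M (dM v).
  rewrite (_ : M = id * (cosh - cst 1) - q \*: (sinh - id))//.
  by apply: is_derive_eq; rewrite /dM /GRing.scale/= !fctE; ring.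
have Mu : M 0 < M u.
  apply: (is_derive_gt0_lt M dM) => // v /andP[v0 _].
  have c1 := cosh_gt1 v v0.
  have : cosh v - 1 < v * sinh v.
    pose L x := x * sinh x - cosh x.
    have dL (x : R) : is_derive x (1 : R) L (x * cosh x).
      rewrite (_ : L = id * sinh - cosh)//.
      by apply: is_derive_eq; rewrite /GRing.scale/= ?fctE; ring.
    have : L 0 < L v.
      apply: (is_derive_gt0_lt _ _ _ _ (fun x _ => dL x)) => // x /andP[x0 _].
      by rewrite mulr_gt0// cosh_gt0.
    by rewrite /L sinh0 cosh0; lra.
  by rewrite /dM; nra.
move: Mu; rewrite /M /slope sinh0 cosh0.
have : 0 < u * (k - (q - 1)) by rewrite mulr_gt0// subr_gt0.
by lra.
Qed.

(** The derivative of the opposite function is [N u / u^2] with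
    [N u = u^2 sinh u - q (u cosh u - sinh u)].  As [N 0 = 0] and
    [N' u = (2 - q) u sinh u + u^2 cosh u], the bound [q <= 2] makes [N]
    positive. *)
Lemma sinhc_sub_cosh_decr q u v : 0 < q <= 2 -> 0 < u -> u < v ->
  q * sinh v / v - cosh v < q * sinh u / u - cosh u.
Proof.
move=> /andP[q0 q2] u0 uv.
pose N x := x ^+ 2 * sinh x - q * (x * cosh x - sinh x).
have N_gt0 x : 0 < x -> 0 < N x.
  move=> x0; have dN (y : R) : is_derive y (1 : R) N ((2 - q) * y * sinh y + y ^+ 2 * cosh y).
    rewrite (_ : N = (id ^+ 2) * sinh - q \*: (id * cosh - sinh))//.
    by apply: is_derive_eq; rewrite /GRing.scale/= ?fctE; ring.
  have : N 0 < N x.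
    apply: (is_derive_gt0_lt _ _ _ _ (fun x _ => dN x)) => // y /andP[y0 _].
    have := sinh_gt0 y y0; have := cosh_gt0 y => c0 s0.
    apply: ltr_wpDl; last by rewrite mulr_gt0// exprn_gt0.
    by apply: mulr_ge0; [apply: mulr_ge0; [rewrite subr_ge0|exact: ltW]|exact: ltW].
  by rewrite /N sinh0; lra.
pose H x := cosh x - q * sinh x / x.
pose dH x := N x / x ^+ 2.
have xN0 x : u <= x <= v -> x != 0.
  by move=> /andP[ux _]; rewrite gt_eqF// (lt_le_trans u0).
have dHP (x : R) : u <= x <= v -> is_derive x (1 : R) H (dH x).
  move=> /xN0 x0.
  have dinv := is_deriveV x0 (is_derive_id x (1 : R)).
  have -> : H = cosh - (q \*: sinh) * (fun x => x^-1) by [].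
  apply: is_derive_eq.
  rewrite /dH /N /= /GRing.scale/=.
  by field.
have : H u < H v.
  apply: (is_derive_gt0_lt _ _ _ _ dHP) => // x /andP[ux _].
  have x0 : 0 < x by exact: lt_trans ux.
  by rewrite divr_gt0 ?exprn_gt0// N_gt0.
by rewrite /H; lra.
Qed.
End Hyperbolic.

(** The sign of the slope at [u > 0] is that of
    [q sinh u / u - cosh u - k], a strictly decreasing function of [u]; it is
    enough to find one point of each sign. *)
Lemma slope_sign_change (R : realType) (q k : R) : 0 < q <= 2 -> -1 <= k < q - 1 ->
  exists u0, [/\ 0 < u0, forall u, 0 < u < u0 -> 0 < slope q k u &
                 forall u, u0 < u -> slope q k u < 0].
Proof.
move=> q02 /andP[k1 kq]; have /andP[q0 q2] := q02.
have dcosh (u : R) : derivable cosh u 1 by exact: ex_derive.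
have dslope (u : R) : derivable (slope q k) u 1.
  rewrite (_ : slope q k = q \*: sinh - id * (cosh + cst k)); last by [].
  exact: ex_derive.
have cont (f : R -> R) : (forall u, derivable f u 1) -> continuous f.
  by move=> df x; exact: derivable1_continuous.
have slopeE u : 0 < u -> slope q k u = u * (q * sinh u / u - cosh u - k).
  by move=> u0; rewrite /slope; field; rewrite gt_eqF.
have ge_sinh (u : R) : 0 < u -> u < sinh u.
  move=> u0; have : sinh 0 - 0 < sinh u - u.
    have dsub (x : R) : is_derive x (1 : R) (sinh - id) (cosh x - 1) by exact: is_derive_eq.
    apply: (is_derive_gt0_lt _ _ _ _ (fun x _ => dsub x)) => //.
    by move=> x /andP[x0 _]; rewrite subr_gt0 cosh_gt1.
  by rewrite sinh0; lra.
(* near 0 the quotient [sinh u / u] exceeds 1 while [cosh u] tends to 1 *)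
have [u1 [u10 u14 s1]] : exists u1 : R, [/\ 0 < u1, u1 < 4 & 0 < slope q k u1].
  have cl : cosh u @[u --> 0^'+] --> (cosh 0 : R).
    by apply: cvg_at_right_filter; exact: cont.
  have near1 : \forall u \near (0 : R)^'+, cosh u < q - k.
    apply: (cvgr_lt (cosh 0)) => //; rewrite cosh0; lra.
  near (0 : R)^'+ => u; exists u; split => //.
  rewrite slopeE ?mulr_gt0//.
  have cu : cosh u < q - k by near: u.
  have : 1 < sinh u / u by rewrite ltr_pdivlMr ?mul1r ?ge_sinh.
  rewrite -(ltr_pM2l q0) mulr1 mulrA; lra.
(* at 4 the term [- u cosh u] wins even in the extreme case [q = 2], [k = -1] *)
have s4 : slope q k 4 < 0.
  have e4 : 5 <= expR (4 : R) by have := expR_ge1Dx (4 : R); lra.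
  have em : expR (- (4 : R)) < 1 by rewrite -expR0 ltr_expR oppr_lt0.
  have em0 := expR_gt0 (- (4 : R)).
  rewrite /slope /sinh /cosh.
  move: (expR 4) (expR (- 4)) e4 em em0 => E e E5 e1 e0.
  have : 0 <= (2 - q) * (E - e) by apply: mulr_ge0; lra.
  by lra.
have [u0 u0I E0] : exists2 u0, u0 \in `[u1, 4] & slope q k u0 = 0.
  apply: IVT; first exact: ltW.
    exact: continuous_subspaceT (cont _ dslope).
  by rewrite ge_min le_max (ltW s1) (ltW s4) orbT.
move: u0I; rewrite in_itv/= => /andP[u1u0 _].
have u00 : 0 < u0 by exact: lt_le_trans u1u0.
have H0 : q * sinh u0 / u0 - cosh u0 = k.
  move: E0; rewrite slopeE// => /eqP; rewrite mulf_eq0 (gt_eqF u00)/= subr_eq0.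
  by move/eqP.
exists u0; split => // u.
- move=> /andP[u_gt0 uu0]; rewrite slopeE// mulr_gt0// subr_gt0 -H0.
  exact: sinhc_sub_cosh_decr.
- move=> uu0; have u_gt0 : 0 < u by exact: lt_trans uu0.
  by rewrite slopeE// pmulr_rlt0// subr_lt0 -H0 sinhc_sub_cosh_decr.
Unshelve. all: by end_near. Qed.

(** * The squared modulus *)

(** Completing squares about the mean frequency, the product of the two bells
    is [K = exp (- q / 2) exp (- 2 c y^2)] and their squares are [K exp (- u)]
    and [K exp u]; the interference term carries the cosine of the phase
    difference. *)
Lemma stft_modulus_sqr (R : realType) (sigma xi0 xi1 t eta : R) : 0 < sigma ->
  let c := pi ^+ 2 * sigma ^+ 2 in
  let D := xi1 - xi0 in
  let y := eta - (xi0 + xi1) / 2 in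
  stft_modulus sigma xi0 xi1 t eta ^+ 2 =
  2 * expR (- (c * D ^+ 2 / 2)) *
    (expR (- (2 * c * y ^+ 2)) * (cosh (2 * c * D * y) + cos (2 * pi * D * t))).
Proof.
move=> s0 /=; rewrite /stft_modulus stft_two_tone//.
set c := pi ^+ 2 * sigma ^+ 2; set y := eta - (xi0 + xi1) / 2.
set E0 := expR (- (c * (eta - xi0) ^+ 2)); set E1 := expR (- (c * (eta - xi1) ^+ 2)).
rewrite /expi /= sqr_sqrtr ?addr_ge0 ?sqr_ge0//.
pose a0 := 2 * pi * xi0 * t; pose a1 := 2 * pi * xi1 * t.
have cE : cos (2 * pi * (xi1 - xi0) * t) = cos a1 * cos a0 + sin a1 * sin a0.
  by rewrite -cosB /a0 /a1; congr cos; ring.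
have c0 : cos a0 ^+ 2 = 1 - sin a0 ^+ 2 by exact: cos2sin2.
have c1 : cos a1 ^+ 2 = 1 - sin a1 ^+ 2 by exact: cos2sin2.
pose K := expR (- (c * (xi1 - xi0) ^+ 2 / 2)) * expR (- (2 * c * y ^+ 2)).
have E00 : E0 ^+ 2 = K * expR (- (2 * c * (xi1 - xi0) * y)).
  by rewrite /E0 /K -!expRD -expRM_natl; congr expR; rewrite /y; field.
have E11 : E1 ^+ 2 = K * expR (2 * c * (xi1 - xi0) * y).
  by rewrite /E1 /K -!expRD -expRM_natl; congr expR; rewrite /y; field.
have E01 : E0 * E1 = K.
  by rewrite /E0 /E1 /K -!expRD; congr expR; rewrite /y; field.
rewrite cE /cosh -/a0 -/a1.
transitivity (E0 ^+ 2 * (cos a0 ^+ 2 + sin a0 ^+ 2) + E1 ^+ 2 * (cos a1 ^+ 2 + sin a1 ^+ 2)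
   + 2 * (E0 * E1) * (cos a1 * cos a0 + sin a1 * sin a0)); first by ring.
by rewrite c0 c1 !subrK E00 E11 E01 /K; field.
Qed.

Lemma is_derive_stft_modulus_sqr (R : realType) (sigma xi0 xi1 t eta : R) :
  0 < sigma -> xi0 != xi1 ->
  let c := pi ^+ 2 * sigma ^+ 2 in
  let D := xi1 - xi0 in
  let y := eta - (xi0 + xi1) / 2 in
  is_derive eta (1 : R) (fun eta => stft_modulus sigma xi0 xi1 t eta ^+ 2)
    (4 / D * expR (- (c * D ^+ 2 / 2)) * expR (- (2 * c * y ^+ 2)) *
     slope (c * D ^+ 2) (cos (2 * pi * D * t)) (2 * c * D * y)).
Proof.
move=> s0 x01 /=.
under eq_fun do rewrite stft_modulus_sqr//=.
set c := pi ^+ 2 * sigma ^+ 2; set D := xi1 - xi0; set b := (xi0 + xi1) / 2.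
set K := 2 * _; set k := cos _.
have D0 : D != 0 by rewrite subr_eq0 eq_sym.
have -> : (fun z => K * (expR (- (2 * c * (z - b) ^+ 2)) * (cosh (2 * c * D * (z - b)) + k)))
  = K \*: ((expR \o (fun z => - (2 * c * (z - b) ^+ 2))) *
    ((cosh \o (fun z => 2 * c * D * (z - b))) + cst k)) by [].
apply: is_derive_eq; rewrite /K /slope /= /GRing.scale/= !fctE/=.
by field.
Qed.

(** * Local maxima of even profiles *)

Lemma card_pair (T : Type) (x y : T) : x <> y -> ([set x; y] #= `I_2)%card.
Proof.
move=> xy; apply/eq_cardSP; exists x; first by left.
rewrite (_ : _ `\ x = [set y]); first exact: card_set1.
apply/seteqP; split=> z /=; first by move=> [[->|->]].
by move=> ->; split; [right|move=> yx; apply: xy].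
Qed.

Section LocalMaxima.
Context {R : realType}.
Variables (f df : R -> R).
Hypothesis fdf : forall x, is_derive x (1 : R) f (df x).

Lemma local_maximum_derive0 x : local_maxima f x -> df x = 0.
Proof.
move=> /nbhs_ballP[e /= e0 fmax].
have fx : is_derive x (1 : R) f 0.
  apply: (derive1_at_max (a := x - e) (b := x + e)).
  - by lra.
  - by move=> t _; exact: ex_derive.
  - by rewrite in_itv/=; apply/andP; split; lra.
  move=> t; rewrite in_itv/= => /andP[t1 t2]; apply: fmax.
  by rewrite /ball/= ltr_norml; apply/andP; split; lra.
by rewrite -(@derive_val _ _ _ _ _ _ _ (fdf x)) (@derive_val _ _ _ _ _ _ _ fx).
Qed.

Lemma local_maximum_derive_sign x e : 0 < e ->
  (forall y, x - e < y < x -> 0 < df y) -> (forall y, x < y < x + e -> df y < 0) ->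
  local_maxima f x.
Proof.
move=> e0 incr decr; apply/nbhs_ballP; exists e => //= y.
rewrite /ball/= ltr_norml => /andP[y1 y2].
have [xy|yx|->//] := ltgtP x y; apply: ltW.
- rewrite -ltrN2; apply: (is_derive_gt0_lt (- f) (fun y => - df y)) => //.
  by move=> z /andP[xz zy]; rewrite oppr_gt0 decr// xz/=; lra.
- apply: (is_derive_gt0_lt f df) => //.
  by move=> z /andP[xz zy]; rewrite incr// zy andbT; lra.
Qed.

Lemma not_local_maximum x e : 0 < e ->
  (forall y, x < y < x + e -> 0 < df y) -> ~ local_maxima f x.
Proof.
move=> e0 incr /nbhs_ballP[d /= d0 fmax].
pose y := x + Num.min e d / 2.
have m0 : 0 < Num.min e d by rewrite lt_min e0.
have me : Num.min e d <= e by rewrite ge_min lexx.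
have md : Num.min e d <= d by rewrite ge_min lexx orbT.
have : f y <= f x.
  by apply: fmax; rewrite /ball/= /y opprD addNKr normrN gtr0_norm; lra.
rewrite leNgt => /negP; apply; apply: (is_derive_gt0_lt f df) => //.
- by rewrite /y; lra.
- by rewrite /y => z /andP[xz zy]; rewrite incr// xz/=; lra.
Qed.

End LocalMaxima.

(** Here the derivative of [f] at [x] is a positive factor times an odd function
    [s] of the offset [x - b], so the signs of [s] on the positive half-line
    determine all local maxima of [f]. *)
Section OddProfile.
Context {R : realType}.
Variables (f K s : R -> R) (a b : R).
Hypothesis fdf : forall x, is_derive x (1 : R) f (K x * s (a * (x - b))).
Hypotheses (K_gt0 : forall x, 0 < K x) (a_gt0 : 0 < a).
Hypothesis sN : forall u, s (- u) = - s u.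

Let s_eq0 x : local_maxima f x -> s (a * (x - b)) = 0.
Proof.
move=> /(local_maximum_derive0 _ _ fdf)/eqP.
by rewrite mulf_eq0 gt_eqF//= => /eqP.
Qed.

Let sC x : s (a * (x - b)) = - s (a * (b - x)).
Proof. by rewrite -sN -mulrN opprB. Qed.

Lemma local_maxima_one_bump : (forall u, 0 < u -> s u < 0) -> local_maxima f = [set b].
Proof.
move=> neg; apply/seteqP; split=> x /=.
  move=> /s_eq0 sx; have [xb|bx|//] := ltgtP x b.
    have := neg (a * (b - x)); rewrite mulr_gt0 ?subr_gt0// => /(_ isT).
    by rewrite -oppr_gt0 -sC sx ltxx.
  have := neg (a * (x - b)); rewrite mulr_gt0 ?subr_gt0// => /(_ isT).
  by rewrite sx ltxx.
move=> ->; apply: (local_maximum_derive_sign _ _ fdf _ 1) => // y /andP[y1 y2].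
  by rewrite mulr_gt0// sC oppr_gt0 neg// mulr_gt0// subr_gt0.
by rewrite pmulr_rlt0// neg// mulr_gt0// subr_gt0.
Qed.

Lemma local_maxima_two_bumps u0 : 0 < u0 ->
  (forall u, 0 < u < u0 -> 0 < s u) -> (forall u, u0 < u -> s u < 0) ->
  local_maxima f = [set b - u0 / a; b + u0 / a].
Proof.
move=> u00 pos neg; set y0 := u0 / a.
have y00 : 0 < y0 by exact: divr_gt0.
have inner z : 0 < z < y0 -> 0 < s (a * z).
  move=> /andP[z0 zy]; rewrite pos// mulr_gt0//=.
  by rewrite mulrC -ltr_pdivlMr.
have outer z : y0 < z -> s (a * z) < 0.
  by move=> yz; rewrite neg// mulrC -ltr_pdivrMr.
apply/seteqP; split=> x /=.
  move=> mx; have sx := s_eq0 _ mx.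
  have [xb|bx|xb] := ltgtP x b; last first.
  - exfalso; apply: (not_local_maximum _ _ fdf x y0 y00 _ mx) => y /andP[xy yx].
    by rewrite mulr_gt0// inner// subr_gt0 -xb xy/=; lra.
  - right; have [xy|yx|] := ltgtP (x - b) y0; last by lra.
      by have := inner (x - b); rewrite subr_gt0 bx xy sx ltxx => /(_ isT).
    by have := outer _ yx; rewrite sx ltxx.
  - left; have [xy|yx|] := ltgtP (b - x) y0; last by lra.
      have := inner (b - x); rewrite subr_gt0 xb xy => /(_ isT).
      by rewrite -oppr_lt0 -sC sx ltxx.
    by have := outer _ yx; rewrite -oppr_gt0 -sC sx ltxx.
move=> [->|->]; apply: (local_maximum_derive_sign _ _ fdf _ y0) => // y /andP[y1 y2].
- by rewrite mulr_gt0// sC oppr_gt0 outer//; lra.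
- by rewrite pmulr_rlt0// sC oppr_lt0 inner//; apply/andP; split; lra.
- by rewrite mulr_gt0// inner//; apply/andP; split; lra.
- by rewrite pmulr_rlt0// outer//; lra.
Qed.

End OddProfile.

Lemma local_maxima_sqr (R : realType) (g : R -> R) : (forall x, 0 <= g x) ->
  local_maxima (fun x => g x ^+ 2) = local_maxima g.
Proof.
by move=> g0; apply/seteqP; split=> x; apply: filterS => y; rewrite ler_pXn2r ?nnegrE.
Qed.

Lemma cosD2pi_int (R : realType) (x : R) (k : int) : cos (x + pi *+ 2 *~ k) = cos x.
Proof.
case: k => n; first by rewrite -pmulrn periodicn//; exact: cosD2pi.
by rewrite NegzE mulrNz -pmulrn -[in RHS](subrK (pi *+ 2 *+ n.+1) x) (periodicn (@cosD2pi R)).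
Qed.

(** * The bifurcation *)

(** The dimensionless quantity called [bandwidth] is the [q] described above;
    the assumption on the separation says that it is at most 2. *)
Section Bifurcation.
Variables (R : realType) (sigma xi0 xi1 : R).
Hypotheses (sigma_gt0 : 0 < sigma) (xi_lt : xi0 < xi1).
Local Notation Delta := (xi1 - xi0).
Local Notation bandwidth := (pi ^+ 2 * sigma ^+ 2 * Delta ^+ 2).
Hypothesis D_le : Delta <= Num.sqrt 2 / (pi * sigma).

Lemma bandwidth_gt0 : 0 < bandwidth.
Proof. by rewrite !mulr_gt0 ?exprn_gt0 ?pi_gt0 ?subr_gt0. Qed.

Lemma bandwidth_le2 : bandwidth <= 2.
Proof.
have pi0 := pi_gt0 R; have D0 : 0 < Delta by rewrite subr_gt0.
 move: D_le; rewrite ler_pdivlMr ?mulr_gt0// => Dle.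
rewrite -[leRHS](@sqr_sqrtr R 2)// -!exprMn ler_pXn2r ?nnegrE ?sqrtr_ge0//.
  by rewrite mulrC.
by rewrite !mulr_ge0 ?ltW.
Qed.

(** Removing [k] full turns places the phase [2 pi Delta t] strictly between
    [a] and [2 pi - a], where [cos a = bandwidth - 1]. *)
Lemma cos_between_bifurcations t k :
  bifurcation_timeL sigma Delta k < t < bifurcation_timeR sigma Delta k ->
  cos (2 * pi * Delta * t) < bandwidth - 1.
Proof.
rewrite /bifurcation_timeL /bifurcation_timeR => /andP[tL tR].
have pi0 := pi_gt0 R; have q0 := bandwidth_gt0; have q2 := bandwidth_le2.
have D0 : 0 < Delta by rewrite subr_gt0.
set q := bandwidth in tL tR q0 q2 *; set D := Delta in tL tR D0 *.
have q1 : -1 <= q - 1 <= 1 by apply/andP; split; lra.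
have a0 := acos_ge0 q1; have api := acos_lepi q1; have aE := acosK q1.
set a := acos (q - 1) in tL tR a0 api aE.
pose u := 2 * pi * D * t - pi *+ 2 *~ k.
have uE : cos u = cos (2 * pi * D * t) by rewrite /u -mulrNz cosD2pi_int.
have pD : 0 < 2 * pi * D by rewrite !mulr_gt0.
have u1 : a < u.
  move: tL; rewrite -(ltr_pM2l pD) /u -mulrzr -mulr_natl.
  rewrite [ltLHS](_ : _ = a + 2 * pi * k%:~R); first by move=> ?; lra.
  move: (pi) (lt0r_neq0 pi0) (lt0r_neq0 D0) => P P0 D0'; field.
  by rewrite P0 D0'.
have u2 : u < 2 * pi - a.
  move: tR; rewrite -(ltr_pM2l pD) /u -mulrzr -mulr_natl intrD.
  rewrite [ltRHS](_ : _ = 2 * pi - a + 2 * pi * k%:~R); first by move=> ?; lra.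
  move: (pi) (lt0r_neq0 pi0) (lt0r_neq0 D0) => P P0 D0'; field.
  by rewrite P0 D0'.
rewrite -uE -[ltRHS]aE.
have [up|up] := leP u pi.
  by rewrite ltr_cos// in_itv/=; apply/andP; split; lra.
rewrite -[ltLHS]cosN -(cosD2pi (- u)).
by rewrite ltr_cos ?in_itv//=; try (apply/andP; split); lra.
Qed.

(** Removing [k] full turns places the phase strictly between [- a] and [a]. *)
Lemma cos_around_bifurcation t k :
  bifurcation_timeR sigma Delta (k - 1) < t < bifurcation_timeL sigma Delta k ->
  bandwidth - 1 < cos (2 * pi * Delta * t).
Proof.
rewrite /bifurcation_timeL /bifurcation_timeR subrK => /andP[tL tR].
have pi0 := pi_gt0 R; have q0 := bandwidth_gt0; have q2 := bandwidth_le2.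
have D0 : 0 < Delta by rewrite subr_gt0.
set q := bandwidth in tL tR q0 q2 *; set D := Delta in tL tR D0 *.
have q1 : -1 <= q - 1 <= 1 by apply/andP; split; lra.
have a0 := acos_ge0 q1; have api := acos_lepi q1; have aE := acosK q1.
set a := acos (q - 1) in tL tR a0 api aE.
pose u := 2 * pi * D * t - pi *+ 2 *~ k.
have uE : cos u = cos (2 * pi * D * t) by rewrite /u -mulrNz cosD2pi_int.
have pD : 0 < 2 * pi * D by rewrite !mulr_gt0.
have u1 : - a < u.
  move: tL; rewrite -(ltr_pM2l pD) /u -mulrzr -mulr_natl.
  rewrite [ltLHS](_ : _ = - a + 2 * pi * k%:~R); first by move=> ?; lra.
  move: (pi) (lt0r_neq0 pi0) (lt0r_neq0 D0) => P P0 D0'; field.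
  by rewrite P0 D0'.
have u2 : u < a.
  move: tR; rewrite -(ltr_pM2l pD) /u -mulrzr -mulr_natl.
  rewrite [ltRHS](_ : _ = a + 2 * pi * k%:~R); first by move=> ?; lra.
  move: (pi) (lt0r_neq0 pi0) (lt0r_neq0 D0) => P P0 D0'; field.
  by rewrite P0 D0'.
rewrite -uE -[ltLHS]aE.
have [up|up] := leP 0 u.
  by rewrite ltr_cos ?in_itv//=; try (apply/andP; split); lra.
rewrite -[ltRHS]cosN.
by rewrite ltr_cos ?in_itv//=; try (apply/andP; split); lra.
Qed.

Let dmod t eta :=
  is_derive_stft_modulus_sqr R sigma xi0 xi1 t eta sigma_gt0 (negbT (lt_eqF xi_lt)).

Let rate_gt0 : 0 < 2 * (pi ^+ 2 * sigma ^+ 2) * Delta.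
Proof. by rewrite !mulr_gt0 ?exprn_gt0 ?pi_gt0 ?subr_gt0. Qed.

Let amplitude_gt0 eta : 0 < 4 / Delta * expR (- (bandwidth / 2)) *
    expR (- (2 * (pi ^+ 2 * sigma ^+ 2) * (eta - (xi0 + xi1) / 2) ^+ 2)).
Proof. by rewrite !mulr_gt0 ?expR_gt0 ?invr_gt0 ?subr_gt0. Qed.

Lemma two_local_maxima t : cos (2 * pi * Delta * t) < bandwidth - 1 ->
  (local_maxima (stft_modulus sigma xi0 xi1 t) #= `I_2)%card.
Proof.
move=> kq.
have q02 : 0 < bandwidth <= 2 by rewrite bandwidth_gt0 bandwidth_le2.
have k1 : -1 <= cos (2 * pi * Delta * t) < bandwidth - 1 by rewrite cos_geN1.
have [u0 [u00 pos neg]] := slope_sign_change R _ _ q02 k1.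
rewrite -(local_maxima_sqr R _ (fun=> sqrtr_ge0 _)).
rewrite (local_maxima_two_bumps _ _ _ _ _ (dmod t) amplitude_gt0 rate_gt0
  (slopeN _ _) _ u00 pos neg).
apply: card_pair => /eqP; rewrite -subr_eq0 opprD addrACA subrr add0r -opprD oppr_eq0.
by rewrite gt_eqF// addr_gt0// divr_gt0.
Qed.

Lemma one_local_maximum t : bandwidth - 1 < cos (2 * pi * Delta * t) ->
  (local_maxima (stft_modulus sigma xi0 xi1 t) #= `I_1)%card.
Proof.
move=> qk.
rewrite -(local_maxima_sqr R _ (fun=> sqrtr_ge0 _)).
rewrite (local_maxima_one_bump _ _ _ _ _ (dmod t) amplitude_gt0 rate_gt0
  (slopeN _ _) (fun u => slope_lt0 _ _ u bandwidth_le2 qk)).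
exact: card_set1.
Qed.

End Bifurcation.

(** * The length of an ellipse *)

Lemma continuous_neq0_sign (R : realType) (f : R -> R) (a b : R) : continuous f ->
  (forall s, a < s < b -> f s != 0) ->
  (forall s, a < s < b -> 0 < f s) \/ (forall s, a < s < b -> f s < 0).
Proof.
move=> cf f0.
have [[s [sab fs]]|neg] := pselect (exists s, a < s < b /\ 0 < f s); last first.
  right=> s sab; rewrite lt_neqAle f0//= leNgt; apply/negP => fs.
  by apply: neg; exists s.
left=> t tab; rewrite lt_neqAle eq_sym f0//= leNgt; apply/negP => ft.
have /andP[sa sb] := sab; have /andP[ta tb] := tab.
have [st|ts|st] := ltgtP s t; last by move: fs; rewrite st ltNge (ltW ft).
- have [|c] := @IVT R f s t 0 (ltW st) (continuous_subspaceT cf).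
    by rewrite ge_min le_max (ltW ft) (ltW fs) orbT.
  rewrite in_itv/= => /andP[sc ct] /eqP; apply/negP/f0.
  by rewrite (lt_le_trans sa sc) (le_lt_trans ct tb).
- have [|c] := @IVT R f t s 0 (ltW ts) (continuous_subspaceT cf).
    by rewrite ge_min le_max (ltW ft) (ltW fs) orbT.
  rewrite in_itv/= => /andP[sc ct] /eqP; apply/negP/f0.
  by rewrite (lt_le_trans ta sc) (le_lt_trans ct sb).
Qed.

Lemma continuous_has_primitive (R : realType) (f : R -> R) (a b : R) : continuous f ->
  exists P : R -> R, forall s, a <= s <= b -> is_derive s (1 : R) P (f s).
Proof.
move=> cf; exists (fun s => \int[lebesgue_measure]_(t in `[a - 1, s]) f t).
move=> s /andP[sa sb].
have intf : lebesgue_measure.-integrable `[a - 1, b + 1] (EFin \o f).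
  apply: continuous_compact_integrable; first exact: segment_compact.
  exact: continuous_subspaceT.
have sb1 : s < b + 1 by lra.
have as1 : a - 1 < s by lra.
have [dP PE] := continuous_FTC1_closed sb1 intf as1 (cf s).
by apply: DeriveDef; [exact: dP|rewrite -derive1E; exact: PE].
Qed.

Section CircleCurve.
Context {R : realType}.
Variables (X Y dX dY : R -> R) (a b : R).
Hypothesis ab : a < b.
Hypothesis XdX : forall s, is_derive s (1 : R) X (dX s).
Hypothesis YdY : forall s, is_derive s (1 : R) Y (dY s).
Hypothesis circle : forall s, a <= s < b -> X s ^+ 2 + Y s ^+ 2 = 1.
Let omega s := X s * dY s - Y s * dX s.

(** The velocity of a curve on the unit circle is orthogonal to its position,
    hence is [omega] times the position turned by a right angle. *)
Lemma circle_derive s : a < s < b -> dX s = - (omega s * Y s) /\ dY s = omega s * X s.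
Proof.
move=> sab.
have XY : X s * dX s + Y s * dY s = 0.
  have d2 : is_derive s (1 : R) (X ^+ 2 + Y ^+ 2) (2 * (X s * dX s + Y s * dY s)).
    apply: (is_derive_eq (is_deriveD (is_deriveX 2 (XdX s)) (is_deriveX 2 (YdY s)))).
    by rewrite /GRing.scale/=; ring.
  have d0 : is_derive s (1 : R) (X ^+ 2 + Y ^+ 2) 0.
    apply: (near_eq_is_derive (f := cst (1 : R))).
      near=> t; rewrite !fctE circle//.
      have : t \in `]a, b[ by near: t; apply: near_in_itvoo; rewrite in_itv.
      by rewrite in_itv/= => /andP[at1 tb]; rewrite tb ltW.
  have e2 := @derive_val _ _ _ _ _ _ _ d2; have e0 := @derive_val _ _ _ _ _ _ _ d0.
  have /esym/eqP := etrans (esym e0) e2.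
  by rewrite mulf_eq0 pnatr_eq0/= => /eqP.
have c1 : X s ^+ 2 + Y s ^+ 2 = 1 by apply: circle; have /andP[? ?] := sab; rewrite ltW.
split; rewrite /omega.
- transitivity (dX s * (X s ^+ 2 + Y s ^+ 2) - X s * (X s * dX s + Y s * dY s)).
    by rewrite c1 XY; ring.
  by ring.
- transitivity (dY s * (X s ^+ 2 + Y s ^+ 2) - Y s * (X s * dX s + Y s * dY s)).
    by rewrite c1 XY; ring.
  by ring.
Unshelve. all: by end_near. Qed.

Hypothesis XYinj : forall s t, a <= s < b -> a <= t < b -> X s = X t -> Y s = Y t -> s = t.

(** The primitive [P] of the angular velocity [omega] measures the angle
    travelled.  If it exceeded [2 pi], it would take the value [2 pi] at some
    parameter strictly between [a] and [b], where the curve would be back at its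
    starting point. *)
Lemma circle_angle_le_2pi (P : R -> R) : (forall s, a <= s <= b -> is_derive s (1 : R) P (omega s)) ->
  P b - P a <= pi *+ 2.
Proof.
move=> dP; rewrite leNgt; apply/negP => Pab.
pose al s := P s - P a.
have dal s : a <= s <= b -> is_derive s (1 : R) al (omega s).
  move=> /dP ?; rewrite (_ : al = P - cst (P a))//.
  by apply: is_derive_eq; rewrite subr0.
have cal : {within `[a, b], continuous al}.
  apply: derivable_within_continuous => x; rewrite in_itv/= => xab.
  by have := dal x xab => ?; exact: ex_derive.
have pi0 := pi_gt0 R.
have [|s sI als] := @IVT R al a b (pi *+ 2) (ltW ab) cal.
  have al2 : al a <= pi *+ 2 by rewrite /al subrr mulrn_wge0// ltW.
  by rewrite ge_min le_max al2 (ltW Pab) orbT.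
move: sI; rewrite in_itv/= => /andP[sa sb].
have as' : a < s.
  rewrite lt_neqAle sa andbT; apply/eqP => sE.
  by move: als; rewrite -sE /al subrr => /esym/eqP; rewrite mulrn_eq0/= gt_eqF.
have sb' : s < b.
  rewrite lt_neqAle sb andbT; apply/eqP => sE.
  by move: Pab; rewrite -sE -als /al ltxx.
(* [X cos al + Y sin al] and [Y cos al - X sin al] are the coordinates of the
   point turned back by the angle [al] travelled; they are constant *)
have dU u : a <= u <= s -> is_derive u (1 : R) (X * (cos \o al) + Y * (sin \o al))
    (dX u * cos (al u) - X u * sin (al u) * omega u + dY u * sin (al u) + Y u * cos (al u) * omega u).
  move=> /andP[ua us]; have dalu : is_derive u (1 : R) al (omega u).
    by apply: dal; rewrite ua (le_trans us).
  apply: (is_derive_eq (is_deriveD (is_deriveM (XdX u) (is_derive1_comp (is_derive_cos _) dalu))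
    (is_deriveM (YdY u) (is_derive1_comp (is_derive_sin _) dalu)))).
  by rewrite /GRing.scale/=; ring.
have dV u : a <= u <= s -> is_derive u (1 : R) (Y * (cos \o al) - X * (sin \o al))
    (dY u * cos (al u) - Y u * sin (al u) * omega u - dX u * sin (al u) - X u * cos (al u) * omega u).
  move=> /andP[ua us]; have dalu : is_derive u (1 : R) al (omega u).
    by apply: dal; rewrite ua (le_trans us).
  apply: (is_derive_eq (is_deriveB (is_deriveM (YdY u) (is_derive1_comp (is_derive_cos _) dalu))
    (is_deriveM (XdX u) (is_derive1_comp (is_derive_sin _) dalu)))).
  by rewrite /GRing.scale/=; ring.
have frozen (f df : R -> R) : (forall u, a <= u <= s -> is_derive u (1 : R) f (df u)) ->
    (forall u, a < u < s -> df u = 0) -> f s = f a.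
  move=> fdf df0.
  have fas : {within `[a, s], continuous f}.
    apply: derivable_within_continuous => x; rewrite in_itv/= => xab.
    by have := fdf x xab => ?; exact: ex_derive.
  have fdf' x : x \in `]a, s[ -> is_derive x (1 : R) f (df x).
    by rewrite in_itv/= => /andP[ax xb]; apply: fdf; rewrite !ltW.
  have [x xas E] := MVT as' fdf' fas.
  by apply/eqP; rewrite -subr_eq0 E df0 ?mul0r//; rewrite in_itv in xas.
have tan u : a < u < s -> dX u = - (omega u * Y u) /\ dY u = omega u * X u.
  by move=> /andP[au us]; apply: circle_derive; rewrite au (lt_trans us).
have Us : X s = X a.
  have := frozen _ _ dU; rewrite /= !fctE/= als /al subrr cos0 sin0 cos2pi sin2pi !mulr1 !mulr0 !addr0.
  by apply=> u /tan[-> ->]; ring.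
have Vs : Y s = Y a.
  have := frozen _ _ dV; rewrite /= !fctE/= als /al subrr cos0 sin0 cos2pi sin2pi !mulr1 !mulr0 !subr0.
  by apply=> u /tan[-> ->]; ring.
have sE : s = a by apply: XYinj; rewrite ?lexx ?ab// sb' ltW.
by move: as'; rewrite sE ltxx.
Qed.

Lemma circle_length_le_pos : continuous omega -> (forall s, a < s < b -> 0 < omega s) ->
  (\int[lebesgue_measure]_(s in `]a, b[) (`|omega s|)%:E <= (pi *+ 2)%:E)%E.
Proof.
move=> com om0.
have [P dP] := continuous_has_primitive _ omega a b com.
have cP s : a <= s <= b -> {for s, continuous P}.
  move=> /dP ?; apply: derivable1_continuous.
  exact: ex_derive.
rewrite (_ : (\int[_]_(s in _) _)%E = (\int[lebesgue_measure]_(s in `[a, b]) (omega s)%:E)%E); last first.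
  rewrite (integral_itv_bndoo true false) //.
    apply: eq_integral => s; rewrite inE/= in_itv/= => sab.
    by rewrite ger0_norm// ltW// om0.
  by apply/measurable_EFinP; apply: measurable_funTS; exact: continuous_measurable_fun.
rewrite (continuous_FTC2 (F := P) ab).
- by rewrite -EFinB lee_fin; exact: circle_angle_le_2pi.
- exact: continuous_subspaceT.
- split.
  + move=> s; rewrite in_itv/= => /andP[sa sb]; apply: ex_derive.
    by apply: dP; rewrite !ltW.
  + by apply: cvg_at_right_filter; apply: cP; rewrite lexx ltW.
  + by apply: cvg_at_left_filter; apply: cP; rewrite lexx ltW.
- move=> s; rewrite in_itv/= => /andP[sa sb]; rewrite derive1E.
  by apply: derive_val; apply: dP; rewrite !ltW.
Qed.

End CircleCurve.

(** The angular velocity has a constant sign; reflecting the curve in the first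
    axis changes that sign, so it may be taken positive, and the length is then
    the total angle. *)
Lemma circle_length_le (R : realType) (X Y dX dY : R -> R) (a b : R)
  (omega := fun s => X s * dY s - Y s * dX s) : a < b ->
  (forall s, is_derive s (1 : R) X (dX s)) -> (forall s, is_derive s (1 : R) Y (dY s)) ->
  continuous dX -> continuous dY ->
  (forall s, a <= s < b -> X s ^+ 2 + Y s ^+ 2 = 1) ->
  (forall s t, a <= s < b -> a <= t < b -> X s = X t -> Y s = Y t -> s = t) ->
  (forall s, a < s < b -> omega s != 0) ->
  (\int[lebesgue_measure]_(s in `]a, b[) (`|omega s|)%:E <= (pi *+ 2)%:E)%E.
Proof.
move=> ab XdX YdY cdX cdY circle inj om0.
have cX : continuous X.
  by move=> s; apply: derivable1_continuous; exact: ex_derive.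
have cY : continuous Y.
  by move=> s; apply: derivable1_continuous; exact: ex_derive.
have com : continuous omega.
  by move=> s; apply: cvgB; apply: cvgM; [exact: cX|exact: cdY|exact: cY|exact: cdX].
have [pos|neg] := continuous_neq0_sign _ omega a b com om0.
  exact: (circle_length_le_pos _ _ _ _ _ _ ab XdX YdY circle inj com pos).
pose omega' s := X s * (- dY s) - (- Y s) * dX s.
have omE s : omega' s = - omega s by rewrite /omega' /omega; ring.
rewrite (_ : (\int[_]_(s in _) _)%E = (\int[lebesgue_measure]_(s in `]a, b[) (`|omega' s|)%:E)%E); last first.
  by apply: eq_integral => s _; rewrite omE normrN.
apply: (circle_length_le_pos X (- Y) dX (- dY)) => //.
- by move=> s sab; rewrite sqrrN circle.
- by move=> s t sab tab Xst /oppr_inj; exact: inj.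
- by rewrite (_ : (fun s => _) = - omega); [move=> s; apply: cvgN; exact: com|exact/funext].
- by move=> s sab; have := neg s sab; rewrite -oppr_gt0 -omE.
Qed.

(** In the rescaled coordinates [X], [Y] the velocity of the ellipse is
    [omega (- A Y, B X)], whose norm is at most [(A + B) |omega|].  Regularity
    forbids [omega] to vanish.  The closing parameter [b] is handled by
    integrating over the open interval. *)
Lemma ellipse_arc_length_integral_le (R : realType) (x0 y0 A B M a b : R)
    (c : R -> R * R) (F : R * R -> R)
    (E := [set p : R * R | ((p.1 - x0) / A) ^+ 2 + ((p.2 - y0) / B) ^+ 2 = 1]) :
  0 < A -> 0 < B -> regular_param E a b c ->
  measurable_fun setT (F \o c) -> (forall p, E p -> 0 <= F p <= M) ->
  (arc_length_integral a b c F <= (M * (A + B) * (pi *+ 2))%:E)%E.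
Proof.
move=> A0 B0 [ab [dx cdx] [dy cdy] speed0 [cE cinj _]] mF FM.
pose X s := ((c s).1 - x0) / A; pose Y s := ((c s).2 - y0) / B.
pose dX s := derive1 (fst \o c) s / A; pose dY s := derive1 (snd \o c) s / B.
have XdX s : is_derive s (1 : R) X (dX s).
  have dxs : is_derive s (1 : R) (fst \o c) (derive1 (fst \o c) s).
    by apply: DeriveDef; [exact: dx|rewrite derive1E].
  rewrite (_ : X = A^-1 \*: ((fst \o c) - cst x0)); last first.
    by apply/funext => u; rewrite /X mulrC.
  by apply: (is_derive_eq (is_deriveZ _ (is_deriveB dxs (is_derive_cst _ _ _)))); rewrite subr0 /GRing.scale/= mulrC.
have YdY s : is_derive s (1 : R) Y (dY s).
  have dys : is_derive s (1 : R) (snd \o c) (derive1 (snd \o c) s).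
    by apply: DeriveDef; [exact: dy|rewrite derive1E].
  rewrite (_ : Y = B^-1 \*: ((snd \o c) - cst y0)); last first.
    by apply/funext => u; rewrite /Y mulrC.
  by apply: (is_derive_eq (is_deriveZ _ (is_deriveB dys (is_derive_cst _ _ _)))); rewrite subr0 /GRing.scale/= mulrC.
have cdX : continuous dX by move=> s; apply: cvgM; [exact: cdx|exact: cvg_cst].
have cdY : continuous dY by move=> s; apply: cvgM; [exact: cdy|exact: cvg_cst].
have Ec s : a <= s < b -> E (c s) by move=> sab; apply: cE; rewrite /= in_itv.
have circle s : a <= s < b -> X s ^+ 2 + Y s ^+ 2 = 1 by exact: Ec.
have inj s t : a <= s < b -> a <= t < b -> X s = X t -> Y s = Y t -> s = t.
  move=> sab tab XE YE; apply: cinj; rewrite ?inE/= ?in_itv//=.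
  rewrite [LHS]surjective_pairing [RHS]surjective_pairing.
  congr (_, _).
    by apply: (addIr (- x0)); apply: (mulIf (invr_neq0 (lt0r_neq0 A0))).
  by apply: (addIr (- y0)); apply: (mulIf (invr_neq0 (lt0r_neq0 B0))).
pose omega s := X s * dY s - Y s * dX s.
have speedE s : a < s < b -> curve_speed c s = Num.sqrt (omega s ^+ 2 * (A ^+ 2 * Y s ^+ 2 + B ^+ 2 * X s ^+ 2)).
  move=> sab.
  have [dXE dYE] : dX s = - (omega s * Y s) /\ dY s = omega s * X s.
    exact: (circle_derive _ _ _ _ _ _ XdX YdY circle s sab).
  rewrite /curve_speed; congr Num.sqrt.
  have -> : derive1 (fst \o c) s = A * dX s by rewrite /dX mulrC divfK// gt_eqF.
  have -> : derive1 (snd \o c) s = B * dY s by rewrite /dY mulrC divfK// gt_eqF.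
  by rewrite dXE dYE; ring.
have speed_le s : a < s < b -> curve_speed c s <= (A + B) * `|omega s|.
  move=> sab; have sab' : a <= s < b by have /andP[? ?] := sab; rewrite ltW.
  have v0 : 0 <= (A + B) * `|omega s| by rewrite mulr_ge0// addr_ge0// ltW.
  rewrite speedE// -[leRHS](ger0_norm v0) -sqrtr_sqr ler_sqrt ?sqr_ge0//.
  rewrite [leRHS]exprMn real_normK ?num_real// mulrC ler_wpM2r ?sqr_ge0//.
  have := circle s sab'; have := sqr_ge0 (X s); have := sqr_ge0 (Y s).
  move: (X s ^+ 2) (Y s ^+ 2) => x y y_ge0 x_ge0 xy.
  have Ay : A ^+ 2 * y <= A ^+ 2 by rewrite ler_piMr ?sqr_ge0//; lra.
  have Bx : B ^+ 2 * x <= B ^+ 2 by rewrite ler_piMr ?sqr_ge0//; lra.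
  apply: (le_trans (lerD Ay Bx)).
  by rewrite sqrrD addrAC lerDl mulrn_wge0// mulr_ge0// ltW.
have om0 s : a < s < b -> omega s != 0.
  move=> sab; apply: contra_neq (speed0 s _) => [om|].
    by rewrite speedE// om expr0n/= mul0r sqrtr0.
  by have /andP[? ?] := sab; rewrite !ltW.
have mspeed : measurable_fun setT (curve_speed c).
  rewrite (_ : curve_speed c = Num.sqrt \o
    (fun s => derive1 (fst \o c) s ^+ 2 + derive1 (snd \o c) s ^+ 2))//.
  apply: continuous_measurable_fun => s.
  apply: continuous_comp; last exact: sqrt_continuous.
  exact: (cvgD (cvgM (cdx s) (cdx s)) (cvgM (cdy s) (cdy s))).
have mom : measurable_fun setT omega.
  apply: continuous_measurable_fun => s.
  have cXs : {for s, continuous X}.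
    by apply: derivable1_continuous; exact: ex_derive.
  have cYs : {for s, continuous Y}.
    by apply: derivable1_continuous; exact: ex_derive.
  by apply: cvgB; apply: cvgM; [exact: cXs|exact: cdY|exact: cYs|exact: cdX].
have := circle_length_le _ _ _ _ _ _ _ ab XdX YdY cdX cdY circle inj om0.
rewrite -/(omega) => len.
have mFs : measurable_fun setT (fun s => (F (c s) * curve_speed c s)%:E).
  by apply/measurable_EFinP; apply: measurable_funM.
rewrite /arc_length_integral (integral_itv_bndoo true false); last exact: measurable_funTS.
have [p0 Ep0] : exists p, E p by exists (c a); apply: Ec; rewrite lexx.
have M0 : 0 <= M by have /andP[] := FM _ Ep0; exact: le_trans.
have MAB : 0 <= M * (A + B) by rewrite mulr_ge0// addr_ge0// ltW.
apply: (@le_trans _ _ (\int[lebesgue_measure]_(s in `]a, b[) ((M * (A + B))%:E * (`|omega s|)%:E))%E).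
  apply: ge0_le_integral => //.
  - move=> s; rewrite /= in_itv/= => /andP[sa sb]; rewrite lee_fin mulr_ge0 ?sqrtr_ge0//.
    have sab : a <= s < b by rewrite sb ltW.
    by have /andP[] := FM _ (Ec s sab).
  - exact: measurable_funTS.
  - by apply/measurable_EFinP; apply: measurable_funM => //; apply: measurable_funTS; exact: measurableT_comp.
  - move=> s; rewrite /= in_itv/= => sab; have /andP[sa sb] := sab.
    have /andP[F0 FMs] : 0 <= F (c s) <= M by apply/FM/Ec; rewrite sb ltW.
    rewrite -EFinM lee_fin -mulrA ler_pM ?sqrtr_ge0//; exact: speed_le.
rewrite ge0_integralZl//.
- by rewrite [leRHS]EFinM lee_wpmul2l// lee_fin.
- by apply/measurable_EFinP; apply: measurable_funTS; exact: measurableT_comp.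
Qed.

(** * The derivative of the squared modulus on the ellipse *)

Lemma expR_le_inv (R : realType) (u : R) : u < 1 -> expR u <= (1 - u)^-1.
Proof.
move=> u1; rewrite -[leLHS]invrK -expRN lef_pV2 ?posrE ?expR_gt0 ?subr_gt0//.
exact: expR_ge1Dx.
Qed.

Lemma cosh_le_quad (R : realType) (u : R) : `|u| <= 2^-1 -> cosh u <= 1 + 2 * u ^+ 2.
Proof.
rewrite ler_norml => /andP[u1 u2].
have E1 : expR u <= (1 - u)^-1 by apply: expR_le_inv; lra.
have E2 : expR (- u) <= (1 + u)^-1.
  by rewrite -[X in (1 + X)^-1]opprK; apply: expR_le_inv; lra.
have E3 : (1 - u)^-1 + (1 + u)^-1 <= 2 * (1 + 2 * u ^+ 2).
  rewrite -subr_ge0 (_ : _ - _ = 2 * (u ^+ 2 * (1 - 2 * u ^+ 2)) / ((1 - u) * (1 + u))).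
    have u4 : u ^+ 2 <= 4^-1 by nra.
    apply: divr_ge0; last by apply: mulr_ge0; lra.
    by apply: mulr_ge0 => //; apply: mulr_ge0; [exact: sqr_ge0|lra].
  by field; rewrite !gt_eqF//; lra.
by rewrite /cosh; lra.
Qed.

Lemma norm_sinh_le (R : realType) (u : R) : `|u| <= 2^-1 -> `|sinh u| <= 2 * `|u|.
Proof.
wlog u0 : u / 0 <= u.
  move=> H; have [u0|/ltW u0] := leP 0 u; first exact: H.
  by rewrite -(normrN (sinh u)) -sinhN -(normrN u); apply: H; rewrite oppr_ge0.
rewrite (ger0_norm u0) => u2.
have E1 : expR u <= (1 - u)^-1 by apply: expR_le_inv; lra.
have E2 : 1 - u <= expR (- u) by exact: expR_ge1Dx.
have E3 : (1 - u)^-1 - (1 - u) <= 4 * u.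
  rewrite -subr_ge0 (_ : _ - _ = u * (2 - 3 * u) / (1 - u)).
    by rewrite divr_ge0 ?mulr_ge0//; lra.
  by field; rewrite gt_eqF//; lra.
have s0 : 0 <= sinh u.
  by move: u0; rewrite le_eqVlt => /predU1P[<-|/sinh_gt0/ltW//]; rewrite sinh0.
by rewrite (ger0_norm s0) /sinh; lra.
Qed.

(** Writing [cosh u + k = (cosh u - 1) + (1 + k)], both terms are of order [q]
    when [u^2] is, so that the slope is [u] times a quantity of order [q]. *)
Lemma norm_slope_le (R : realType) (q k u : R) : 0 <= q <= 8^-1 ->
  u ^+ 2 <= 2 * q -> 0 <= 1 + k <= q -> `|slope q k u| <= 7 * q * `|u|.
Proof.
move=> /andP[q0 q8] uq /andP[k0 kq].
have u2 : `|u| <= 2^-1.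
  rewrite -(ler_pXn2r (n := 2)) ?nnegrE// real_normK ?num_real//.
  by apply: (le_trans uq); rewrite expr2; lra.
have c1 : 0 <= cosh u - 1 by rewrite subr_ge0 cosh_ge1.
have c2 := cosh_le_quad _ _ u2.
have -> : slope q k u = q * sinh u - u * ((cosh u - 1) + (1 + k)).
  by rewrite /slope; ring.
apply: (le_trans (ler_normB _ _)); rewrite (normrM q) (normrM u) (ger0_norm q0).
rewrite (ger0_norm (addr_ge0 c1 k0)).
have h1 : q * `|sinh u| <= q * (2 * `|u|) by rewrite ler_wpM2l// norm_sinh_le.
have h2 : `|u| * (cosh u - 1 + (1 + k)) <= `|u| * (5 * q) by rewrite ler_wpM2l//; lra.
by lra.
Qed.

(** With [a = acos (1 - q)], the mean value theorem gives [sin a >= a / 2], as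
    the cosine is at least 1/2 on [[0, a]]; and
    [sin a ^ 2 = 1 - (1 - q)^2 <= 2 q]. *)
Lemma acos_sqr_le (R : realType) (q : R) : 0 < q <= 2^-1 -> acos (1 - q) ^+ 2 <= 8 * q.
Proof.
move=> /andP[q0 q2]; have q1 : -1 <= 1 - q < 1 by apply/andP; split; lra.
have q1' : -1 <= 1 - q <= 1 by apply/andP; split; lra.
have a0 := acos_gt0 q1; have api := acos_lepi q1'; have aE := acosK q1'.
set a := acos (1 - q) in a0 api aE *.
have [x xI E] := MVT a0 (fun x _ => is_derive_sin x) (continuous_subspaceT (@continuous_sin R)).
move: xI E; rewrite in_itv/= sin0 !subr0 => /andP[x0 xa] sE.
have cx : 1 - q < cos x.
  by rewrite -aE ltr_cos// in_itv/=; apply/andP; split; lra.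
have := sin2cos2 a; rewrite aE sE exprMn => sa.
have : 2^-1 ^+ 2 * a ^+ 2 <= cos x ^+ 2 * a ^+ 2.
  by rewrite ler_wpM2r ?sqr_ge0// ler_pXn2r ?nnegrE//; lra.
rewrite sa; nra.
Qed.

Section EllipseBound.
Variables (R : realType) (sigma xi0 xi1 : R) (k : int).
Hypotheses (sigma_gt0 : 0 < sigma) (xi_lt : xi0 < xi1).
Local Notation Delta := (xi1 - xi0).
Local Notation bandwidth := (pi ^+ 2 * sigma ^+ 2 * Delta ^+ 2).
Local Notation dgamma2 :=
  (fun p : R * R => `| derive1 (fun eta => stft_modulus sigma xi0 xi1 p.1 eta ^+ 2) p.2 |).
Hypothesis bandwidth_small : bandwidth <= 8^-1.

Lemma acos_bandwidth_gt0 : 0 < acos (1 - bandwidth).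
Proof.
have q0 := bandwidth_gt0 R sigma xi0 xi1 sigma_gt0 xi_lt.
have q8 := bandwidth_small.
by apply: acos_gt0; apply/andP; split; lra.
Qed.

Lemma bifurcation_ellipseE :
  bifurcation_ellipse sigma xi0 xi1 k =
  [set p : R * R |
    ((p.1 - (k%:~R + 1 / 2) / Delta) / (acos (1 - bandwidth) / (2 * pi * Delta))) ^+ 2
    + ((p.2 - (xi0 + xi1) / 2) / (Num.sqrt 2 * pi * sigma)^-1) ^+ 2 = 1].
Proof.
have pi0 := pi_gt0 R; have D0 : 0 < Delta by rewrite subr_gt0.
have q0 := bandwidth_gt0 R sigma xi0 xi1 sigma_gt0 xi_lt.
have a0 := acos_bandwidth_gt0.
have r0 : 0 < Num.sqrt (2 : R) by rewrite sqrtr_gt0.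
apply/funext => -[t eta]; rewrite /bifurcation_ellipse /=; congr (_ = 1).
rewrite invrK invf_div !exprMn sqr_sqrtr//.
by field; rewrite !gt_eqF.
Qed.

Lemma derive1_stft_modulus_sqr t eta :
  derive1 (fun eta => stft_modulus sigma xi0 xi1 t eta ^+ 2) eta =
  4 / Delta * expR (- (bandwidth / 2)) *
    expR (- (2 * (pi ^+ 2 * sigma ^+ 2) * (eta - (xi0 + xi1) / 2) ^+ 2)) *
  slope bandwidth (cos (2 * pi * Delta * t))
    (2 * (pi ^+ 2 * sigma ^+ 2) * Delta * (eta - (xi0 + xi1) / 2)).
Proof.
rewrite derive1E; apply: derive_val.
exact: (is_derive_stft_modulus_sqr _ _ _ _ _ _ sigma_gt0 (negbT (lt_eqF xi_lt))).
Qed.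

(** On the ellipse [w = 2 pi Delta (t - (k + 1/2) / Delta)] is at most
    [acos (1 - bandwidth)] in absolute value, and the cosine of the phase is
    [- cos w]; this gives the bound on [1 + cos] required by [norm_slope_le],
    and [2 c y^2 <= 1] gives the bound on [u]. *)
Lemma norm_derive_modulus_sqr_le p : bifurcation_ellipse sigma xi0 xi1 k p ->
  dgamma2 p <= 56 * (pi * sigma) * bandwidth.
Proof.
have pi0 := pi_gt0 R; have D0 : 0 < Delta by rewrite subr_gt0.
have q0 := bandwidth_gt0 R sigma xi0 xi1 sigma_gt0 xi_lt.
have q8 := bandwidth_small.
case: p => t eta; rewrite /bifurcation_ellipse /=.
rewrite derive1_stft_modulus_sqr.
set y := eta - (xi0 + xi1) / 2; set a := acos _.
set w := 2 * pi * Delta * (t - (k%:~R + 1 / 2) / Delta).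
have a0 : 0 < a := acos_bandwidth_gt0.
rewrite (_ : 4 * pi ^+ 2 * _ * _ = w ^+ 2); last by rewrite /w; ring.
rewrite -exprVn -exprMn => El.
have y1 : 2 * (pi ^+ 2 * sigma ^+ 2) * y ^+ 2 <= 1.
  by rewrite -[leRHS]El !mulrA lerDl sqr_ge0.
have wa : `|w| <= a.
  have : (w / a) ^+ 2 <= 1 ^+ 2.
    rewrite expr1n -[leRHS]El lerDr; apply: mulr_ge0; last exact: sqr_ge0.
    by rewrite !mulr_ge0 ?exprn_ge0 ?ltW.
  rewrite -(real_normK (num_real (w / a))) ler_pXn2r ?nnegrE// normrM normfV.
  by rewrite (gtr0_norm a0) ler_pdivrMr// mul1r.
have kE : cos (2 * pi * Delta * t) = - cos w.
  rewrite -cosDpi -(cosD2pi_int _ (w + pi) k); congr cos.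
  rewrite -mulrzr -mulr_natl /w.
  move: (pi) (lt0r_neq0 D0) => P D0'; field.
  by rewrite D0'.
have k0 : 0 <= 1 + cos (2 * pi * Delta * t) <= bandwidth.
  rewrite kE; apply/andP; split; first by rewrite subr_ge0 cos_le1.
  have q1 : -1 <= 1 - bandwidth <= 1 by apply/andP; split; lra.
  suff : 1 - bandwidth <= cos w by lra.
  rewrite -(acosK q1) -/a.
  have -> : cos w = cos `|w| by have [_|_] := ger0P w; rewrite ?cosN.
  move: wa; rewrite le_eqVlt => /predU1P[->//|wa]; rewrite ltW// ltr_cos// in_itv/=.
    by rewrite normr_ge0 (le_trans (ltW wa))// acos_lepi.
  by rewrite ltW//= acos_lepi.
set c := pi ^+ 2 * sigma ^+ 2 in q0 q8 y1 k0 *.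
have c0 : 0 < c by rewrite mulr_gt0 ?exprn_gt0.
have u2 : (2 * c * Delta * y) ^+ 2 <= 2 * (c * Delta ^+ 2).
  rewrite (_ : _ ^+ 2 = 2 * (c * Delta ^+ 2) * (2 * c * y ^+ 2)); last by ring.
  by rewrite ler_piMr// ltW// mulr_gt0.
have sl : `|slope (c * Delta ^+ 2) (cos (2 * pi * Delta * t)) (2 * c * Delta * y)| <=
     7 * (c * Delta ^+ 2) * `|2 * c * Delta * y|.
  by apply: norm_slope_le => //; rewrite (ltW q0).
have cy : c * `|y| <= pi * sigma.
  rewrite -(ler_pXn2r (n := 2)) ?nnegrE ?mulr_ge0 ?(ltW c0) ?(ltW pi0) ?(ltW sigma_gt0)//.
  have -> : (pi * sigma) ^+ 2 = c by rewrite /c; ring.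
  have -> : (c * `|y|) ^+ 2 = c * (c * y ^+ 2).
    by rewrite -(real_normK (num_real y)); ring.
  by rewrite ler_piMr ?(ltW c0)//; lra.
rewrite normrM ger0_norm; last by rewrite !mulr_ge0 ?expR_ge0 ?invr_ge0 ?ltW.
have e1 : expR (- (c * Delta ^+ 2 / 2)) <= 1.
  by rewrite -expR0 ler_expR oppr_le0 divr_ge0 ?ltW.
have e2 : expR (- (2 * c * y ^+ 2)) <= 1.
  rewrite -expR0 ler_expR oppr_le0; apply: mulr_ge0; last exact: sqr_ge0.
  by rewrite mulr_ge0// ltW.
have e12 : 4 / Delta * expR (- (c * Delta ^+ 2 / 2)) * expR (- (2 * c * y ^+ 2)) <= 4 / Delta.
  have d4 : 0 <= 4 / Delta by rewrite divr_ge0 ?ltW.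
  rewrite -mulrA ler_piMr//.
  by rewrite (le_trans (ler_wpM2r (expR_ge0 _) e1))// mul1r.
apply: (le_trans (ler_pM _ _ e12 sl)) => //.
  by rewrite !mulr_ge0 ?expR_ge0 ?invr_ge0 ?ltW.
have cD0 : 0 < 2 * c * Delta by rewrite !mulr_gt0.
rewrite (normrM _ y) (gtr0_norm cD0).
rewrite [leLHS](_ : _ = 56 * (c * `|y|) * (c * Delta ^+ 2)); last by field; rewrite gt_eqF.
by rewrite ler_wpM2r ?(ltW q0)// ler_wpM2l.
Qed.

Lemma measurable_derive_modulus_sqr (c : R -> R * R) :
  measurable_fun setT (fst \o c) -> measurable_fun setT (snd \o c) ->
  measurable_fun setT (dgamma2 \o c).
Proof.
move=> mt my.
rewrite (_ : _ \o c = fun s => `| 4 / Delta * expR (- (bandwidth / 2)) *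
    expR (- (2 * (pi ^+ 2 * sigma ^+ 2) * ((c s).2 - (xi0 + xi1) / 2) ^+ 2)) *
  slope bandwidth (cos (2 * pi * Delta * (c s).1))
    (2 * (pi ^+ 2 * sigma ^+ 2) * Delta * ((c s).2 - (xi0 + xi1) / 2)) |); last first.
  by apply/funext => s /=; rewrite derive1_stft_modulus_sqr.
have mE (f : R -> R) : measurable_fun setT f -> measurable_fun setT (fun s => expR (f s)).
  by move=> mf; exact: measurableT_comp.
have mC (f : R -> R) : measurable_fun setT f -> measurable_fun setT (fun s => cos (f s)).
  move=> mf; apply: measurableT_comp => //.
  by apply: continuous_measurable_fun; exact: continuous_cos.
have mN (f : R -> R) : measurable_fun setT f -> measurable_fun setT (fun s => - f s).
  by move=> mf; exact: measurableT_comp.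
have my' : measurable_fun setT (fun s => (c s).2 - (xi0 + xi1) / 2).
  by apply: measurable_funB.
have mu : measurable_fun setT (fun s => 2 * (pi ^+ 2 * sigma ^+ 2) * Delta * ((c s).2 - (xi0 + xi1) / 2)).
  by apply: measurable_funM.
have mA (f : R -> R) : measurable_fun setT f -> measurable_fun setT (fun s => `|f s|).
  by move=> mf; exact: measurableT_comp.
apply: mA; apply: measurable_funM.
  apply: measurable_funM; first by [].
  apply: mE; apply: mN; apply: measurable_funM; first by [].
  by apply: measurable_funX.
rewrite /slope /sinh /cosh; apply: measurable_funB; apply: measurable_funM => //.
  apply: measurable_funM => //; apply: measurable_funB; first exact: mE.
  by apply: mE; exact: mN.
apply: measurable_funD; last by apply: mC; by apply: measurable_funM.
apply: measurable_funM => //; apply: measurable_funD; first exact: mE.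
by apply: mE; exact: mN.
Qed.

(** The half-axes are at most [2 sigma], by [acos_sqr_le], and
    [1 / (sqrt 2 pi sigma)]; the right-hand side is therefore a constant times
    the square of the separation. *)
Lemma arc_length_integral_derive_le a b c :
  regular_param (bifurcation_ellipse sigma xi0 xi1 k) a b c ->
  (`| arc_length_integral a b c dgamma2 |
     <= (56 * (pi * sigma) * bandwidth * (2 * sigma + (Num.sqrt 2 * pi * sigma)^-1)
          * (pi *+ 2))%:E)%E.
Proof.
move=> Ec.
have pi0 := pi_gt0 R; have D0 : 0 < Delta by rewrite subr_gt0.
have q0 := bandwidth_gt0 R sigma xi0 xi1 sigma_gt0 xi_lt.
have a0 := acos_bandwidth_gt0.
have r0 : 0 < Num.sqrt (2 : R) by rewrite sqrtr_gt0.
rewrite gee0_abs; last first.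
  by apply: integral_ge0 => s _; rewrite lee_fin mulr_ge0// sqrtr_ge0.
have q8 := bandwidth_small.
set A := acos (1 - bandwidth) / (2 * pi * Delta); set B := (Num.sqrt 2 * pi * sigma)^-1.
have A0 : 0 < A by rewrite divr_gt0// !mulr_gt0.
have B0 : 0 < B by rewrite invr_gt0 !mulr_gt0.
have A2 : A <= 2 * sigma.
  rewrite /A ler_pdivrMr ?mulr_gt0//.
  rewrite -(ler_pXn2r (n := 2)) ?nnegrE ?mulr_ge0 ?(ltW a0) ?(ltW pi0) ?(ltW D0) ?(ltW sigma_gt0)//.
  apply: (le_trans (acos_sqr_le _ _ _)); first by apply/andP; split; lra.
  rewrite (_ : (_ * _) ^+ 2 = 16 * bandwidth); last by ring.
  by rewrite ler_wpM2r ?ltW//; lra.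
have [_ [dt _] [de _] _ _] := Ec.
have mt : measurable_fun setT (fst \o c).
  by apply: continuous_measurable_fun => s; exact: derivable1_continuous.
have me : measurable_fun setT (snd \o c).
  by apply: continuous_measurable_fun => s; exact: derivable1_continuous.
have FM p : bifurcation_ellipse sigma xi0 xi1 k p ->
    0 <= dgamma2 p <= 56 * (pi * sigma) * bandwidth.
  by move=> /norm_derive_modulus_sqr_le ->; rewrite normr_ge0.
rewrite bifurcation_ellipseE in Ec FM.
apply: (le_trans (ellipse_arc_length_integral_le _ _ _ _ _ _ _ _ _ _ A0 B0 Ec (measurable_derive_modulus_sqr _ mt me) FM)).
rewrite lee_fin; apply: ler_wpM2r; first by rewrite mulrn_wge0// ltW.
apply: ler_wpM2l; last by rewrite lerD2r.
by rewrite !mulr_ge0 ?ltW.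
Qed.

End EllipseBound.

Theorem theorem1 (R : realType) (sigma : R) (sigma_gt0 : 0 < sigma) :
  (forall xi0 xi1 : R, xi0 < xi1 ->
    let Delta := xi1 - xi0 in
    let gamma := stft_modulus sigma xi0 xi1 in
    let tL := bifurcation_timeL sigma Delta in
    let tR := bifurcation_timeR sigma Delta in
    Delta <= Num.sqrt 2 / (pi * sigma) ->
    (forall t : R, (exists k : int, tL k < t < tR k) ->
      (local_maxima (gamma t) #= `I_2)%card) /\
    (forall t : R, (exists k : int, tR (k - 1) < t < tL k) ->
      (local_maxima (gamma t) #= `I_1)%card))
  /\
  (forall k : int, exists C : R, \forall D \near 0^'+,
    forall xi0 xi1 : R, xi1 - xi0 = D -> D <= Num.sqrt 2 / (pi * sigma) ->
    let gamma := stft_modulus sigma xi0 xi1 in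
    forall (a b : R) (c : R -> R * R),
      regular_param (bifurcation_ellipse sigma xi0 xi1 k) a b c ->
      (`| arc_length_integral a b c
            (fun p => `| derive1 (fun eta => gamma p.1 eta ^+ 2) p.2 |)%R |
        <= (C * D ^+ 2)%R%:E)%E).
Proof.
have pi0 := pi_gt0 R.
split=> [xi0 xi1 x01 D gamma tL tR Dle|k].
  split=> t [k tk].
    by apply: two_local_maxima => //; exact: cos_between_bifurcations tk.
  by apply: one_local_maximum => //; exact: cos_around_bifurcation tk.
exists (56 * (pi * sigma) * (pi ^+ 2 * sigma ^+ 2) *
  (2 * sigma + (Num.sqrt 2 * pi * sigma)^-1) * (pi *+ 2)).
near=> D => xi0 xi1 DE _ a b c Ec.
have D0 : 0 < D by near: D; exact: nbhs_right_gt.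
have Dle : D <= (4 * pi * sigma)^-1.
  by near: D; apply: nbhs_right_le; rewrite invr_gt0 !mulr_gt0.
have x01 : xi0 < xi1 by rewrite -subr_gt0 DE.
have small : pi ^+ 2 * sigma ^+ 2 * (xi1 - xi0) ^+ 2 <= 8^-1.
  have : 4 * pi * sigma * D <= 1.
    by rewrite mulrC -ler_pdivlMr ?mulr_gt0// div1r.
  have : 0 <= pi * sigma * D by rewrite !mulr_ge0 ?ltW.
  rewrite DE -!exprMn -!mulrA; move: (pi * (sigma * D)) => z; nra.
apply: (le_trans (arc_length_integral_derive_le _ _ _ _ _ sigma_gt0 x01 small _ _ _ Ec)).
by rewrite lee_fin DE le_eqVlt; apply/orP; left; apply/eqP; ring.
Unshelve. all: by end_near. Qed.
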